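(* Let $G$ be a countable branch group acting on a regular rooted tree $T$. Then for every ergodic component $\alpha\in\mathcal E=\bigcup_{n\in\mathbb N}\mathcal E_n$ of the symmetrized diagonal actions of $G$ on powers of $(\partial T,\mu)$, the character $\chi_\alpha$ of $G$ is indecomposable.
   Context: Trees. For $d\ge2$ and an alphabet $\mathcal A_d$ with $d$ letters, the $d$-regular rooted tree $T$ has as vertices all finite words over $\mathcal A_d$, two words being adjacent if one is obtained from the other by adding one letter at the end; the root is the empty word; $V_n$ is the set of words of length $n$. The boundary $X=\partial T$ is the space of infinite words over $\mathcal A_d$ (infinite paths from the root), $X_v$ is the set of paths through $v$, $\mu$ is the uniform Bernoulli measure ($\mu(X_v)=d^{-n}$ for $v\in V_n$), and $\Sigma$ is the sigma-algebra of measurable subsets of $X$. For $G<\mathrm{Aut}(T)$, $\mathrm{rist}_G(v)$ is the subgroup of elements acting trivially on the complement of the subtree $T_v$ rooted at $v$, and $\mathrm{rist}_G(n)=\langle\mathrm{rist}_G(v):v\in V_n\rangle$. $G$ is branch if it acts transitively on each level $V_n$ and $\mathrm{rist}_G(n)$ has finite index in $G$ for each $n$. Diagonal actions. For $n\in\mathbb N$, $\mathrm{diag}_n(g)(x_1,\dots,x_n)=(gx_1,\dots,gx_n)$ on $(X^n,\Sigma^n,\mu^n)$; it descends to an action, also denoted $\mathrm{diag}_n$, on $X^n_{\mathrm{Sym}}=X^n/\mathrm{Sym}(n)$ (quotient by permutations of factors) with the projected sigma-algebra and measure $\mu^n_{\mathrm{Sym}}$. $\mathcal E_n$ is the set of ergodic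 components of positive measure of this action, i.e. (modulo null sets) invariant measurable subsets of positive measure on which the action is ergodic; for $\alpha\in\mathcal E_n$, $X_\alpha\subset X^n_{\mathrm{Sym}}$ is the corresponding subset, and $\mu_\alpha$ is the restriction of $\mu^n_{\mathrm{Sym}}$ to $X_\alpha$ normalized so that $\mu_\alpha(X_\alpha)=1$. For $\alpha\in\mathcal E_n$, $\chi_\alpha(g)=\mu_\alpha(\mathrm{Fix}(\mathrm{diag}_n(g))\cap X_\alpha)$, $g\in G$, where $\mathrm{Fix}$ denotes the set of fixed points. Characters. A character on $G$ is a function $\chi:G\to\mathbb C$ with $\chi(g_1g_2)=\chi(g_2g_1)$, positive semi-definite matrices $(\chi(g_ig_j^{-1}))_{i,j}$ for all finite families $g_1,\dots,g_k\in G$, and $\chi(e)=1$; it is indecomposable if it is not of the form $a\chi_1+(1-a)\chi_2$ with $0<a<1$ and distinct characters $\chi_1,\chi_2$. *)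

(* Defs.v *)
From HB Require Import structures.
From mathcomp Require Import all_boot all_order all_algebra all_fingroup.
From mathcomp Require Import generic_quotient sesquilinear spectral complex.
From mathcomp Require Import all_classical all_reals all_analysis.
Set Implicit Arguments.
Unset Strict Implicit.
Unset Printing Implicit Defensive.
Import Order.TTheory GRing.Theory Num.Theory numFieldNormedType.Exports.

Local Open Scope classical_set_scope.
Local Open Scope quotient_scope.

Section Subgroups.
Context {gT : groupType}.
Local Open Scope group_scope.

Definition subgroup_type (G : groupClosed gT) : Type := {x : gT | x \in G}.

HB.instance Definition _ (G : groupClosed gT) :=
  SubChoice.on (subgroup_type G).

Fact subgroup_closed (G : groupClosed gT) : group_closed (fun x => x \in G).
Proof. by split; [exact: gpred1 | exact: gpredF]. Qed.

HB.instance Definition _ (G : groupClosed gT) :=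
  SubChoice_isSubGroup.Build gT (fun x => x \in G) (subgroup_type G)
    (subgroup_closed G).

Definition generated (S : set gT) : set gT :=
  smallest (fun H : set gT => group_closed (mem H)) S.

Definition finite_index (G : groupClosed gT) (H : set gT) :=
  finite_set [set [set (g * h)%g | h in H] | g in [set` G]].

End Subgroups.

Section Characters.
Context {R : realType}.
Local Open Scope ring_scope.
Local Open Scope sesquilinear_scope.

(* The order of R[i] makes 0 <= z mean that z is real and nonnegative. *)
Definition psdmx (k : nat) (M : 'M[R[i]]_k) :=
  forall u : 'rV[R[i]]_k, 0 <= (u *m M *m u ^t*) 0 0.

Definition is_character (gT : groupType) (chi : gT -> R[i]) :=
  [/\ forall g h : gT, chi (g * h)%g = chi (h * g)%g,
      forall (k : nat) (g : 'I_k -> gT),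
        psdmx (\matrix_(i, j) chi (g i * (g j)^-1)%g)
    & chi 1%g = 1].

Definition indecomposable (gT : groupType) (chi : gT -> R[i]) :=
  ~ exists (a : R) (chi1 chi2 : gT -> R[i]),
      [/\ 0 < a < 1, is_character chi1, is_character chi2, chi1 <> chi2
        & forall g, chi g = a%:C%C * chi1 g + (1 - a)%:C%C * chi2 g].

End Characters.

(* For d > 0 this type has exactly d elements; writing it with a successor
   makes it inhabited, which measurable types on words over it require. *)
Notation letter d := 'I_d.-1.+1.
Notation vertex d := (seq (letter d)).

HB.instance Definition _ n := isPointed.Build 'I_n.+1 ord0.

Section TreeAutomorphisms.
Context {d : nat}.
Implicit Types u v w : vertex d.

Definition adjacent u v := exists a, v = rcons u a \/ u = rcons v a.

(* The inverse is stored as data, but it is determined by aut_fun. *)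
Record tree_aut := TreeAut {
  aut_fun :> vertex d -> vertex d;
  aut_inv : vertex d -> vertex d;
  aut_funK : cancel aut_fun aut_inv;
  aut_invK : cancel aut_inv aut_fun;
  aut_root : aut_fun [::] = [::];
  aut_adj : forall u v, adjacent (aut_fun u) (aut_fun v) <-> adjacent u v }.

Lemma tree_aut_eq (g h : tree_aut) : g =1 h -> g = h.
Proof.
case: g h => [f f' fK f'K f0 fA] [h h' hK h'K h0 hA] /= /funext fh.
have fh' : f' = h' by apply/funext => u; rewrite -{1}(h'K u) -fh fK.
by subst h h'; congr TreeAut; exact: Prop_irrelevance.
Qed.

HB.instance Definition _ := gen_eqMixin tree_aut.
HB.instance Definition _ := gen_choiceMixin tree_aut.

Definition aut1 : tree_aut :=
  @TreeAut id id (fun=> erefl) (fun=> erefl) erefl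
    (fun u v => iff_refl (adjacent u v)).

Section Mul.
Variables g h : tree_aut.

Fact aut_mul_root : (g \o h) [::] = [::].
Proof. by rewrite /= !aut_root. Qed.

Fact aut_mul_adj u v : adjacent ((g \o h) u) ((g \o h) v) <-> adjacent u v.
Proof. exact: iff_trans (aut_adj _ _ _) (aut_adj _ _ _). Qed.

Definition aut_mul : tree_aut :=
  TreeAut (can_comp (@aut_funK g) (@aut_funK h))
    (can_comp (@aut_invK h) (@aut_invK g)) aut_mul_root aut_mul_adj.

Fact aut_inv_root : aut_inv g [::] = [::].
Proof. by rewrite -[in LHS](aut_root g) aut_funK. Qed.

Fact aut_inv_adj u v : adjacent (aut_inv g u) (aut_inv g v) <-> adjacent u v.
Proof.
apply: iff_sym; rewrite -{1}[u](aut_invK g) -{1}[v](aut_invK g).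
exact: aut_adj.
Qed.

Definition aut_V : tree_aut :=
  TreeAut (@aut_invK g) (@aut_funK g) aut_inv_root aut_inv_adj.

End Mul.

Fact aut_mulA : associative aut_mul.
Proof. by move=> f g h; exact: tree_aut_eq. Qed.
Fact aut_mul1g : left_id aut1 aut_mul.
Proof. by move=> g; exact: tree_aut_eq. Qed.
Fact aut_mulg1 : right_id aut1 aut_mul.
Proof. by move=> g; exact: tree_aut_eq. Qed.
Fact aut_mulVg : left_inverse aut1 aut_V aut_mul.
Proof. by move=> g; apply: tree_aut_eq => u /=; rewrite aut_funK. Qed.
Fact aut_mulgV : right_inverse aut1 aut_V aut_mul.
Proof. by move=> g; apply: tree_aut_eq => u /=; rewrite aut_invK. Qed.

HB.instance Definition _ := isGroup.Build tree_aut
  aut_mulA aut_mul1g aut_mulg1 aut_mulVg aut_mulgV.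

Lemma aut_rcons (g : tree_aut) u a : exists b, g (rcons u a) = rcons (g u) b.
Proof.
elim/last_ind: u a => [|u c IHu] a.
  have /(aut_adj g) : adjacent [::] (rcons [::] a) by exists a; left.
  case=> b [-> | ]; first by exists b.
  by rewrite aut_root => /esym/(congr1 size); rewrite size_rcons.
have /(aut_adj g) : adjacent (rcons u c) (rcons (rcons u c) a).
  by exists a; left.
case=> b [-> | ]; first by exists b.
have [e ->] := IHu c => /rcons_inj[/(can_inj (@aut_funK g)) ua _].
by move: (congr1 size ua); rewrite !size_rcons => /eqP; rewrite -[X in X == _]addn0 -addn2 eqn_add2l.
Qed.

Lemma size_aut (g : tree_aut) u : size (g u) = size u.
Proof.
elim/last_ind: u => [|u a IHu]; first by rewrite aut_root.
by have [b ->] := aut_rcons g u a; rewrite !size_rcons IHu.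
Qed.

Definition rist (G : {pred tree_aut}) v : set tree_aut :=
  [set g | g \in G /\ forall w, ~~ prefix v w -> g w = w].

Definition level_rist (G : {pred tree_aut}) (n : nat) : set tree_aut :=
  generated (\bigcup_(v in [set v | size v = n]) rist G v).

Definition is_branch (G : groupClosed tree_aut) :=
  (forall n u v, size u = n -> size v = n -> exists2 g, g \in G & g u = v) /\
  (forall n, finite_index G (level_rist G n)).

End TreeAutomorphisms.
Arguments tree_aut d : clear implicits.

Section Boundary.
Context {d : nat}.

Definition cylinder (v : vertex d) : set (nat -> letter d) :=
  [set x | mkseq x (size v) = v].

Definition boundary : Type := g_sigma_algebraType (range cylinder).

HB.instance Definition _ :=
  Measurable.copy boundary (g_sigma_algebraType (range cylinder)).

(* The n-th letter of g x is the last letter of the image under g of the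
   prefix of x of length n + 1; the default value x n is never used. *)
Definition boundary_act (g : tree_aut d) (x : boundary) : boundary :=
  fun n => nth (x n) (g (mkseq x n.+1)) n.

Lemma mkseq_boundary_act (g : tree_aut d) (x : boundary) n :
  mkseq (boundary_act g x) n = g (mkseq x n).
Proof.
elim: n => [|n IHn]; first by rewrite aut_root.
rewrite [LHS]mkseqS IHn {1}/boundary_act.
have [b] := aut_rcons g (mkseq x n) (x n).
rewrite mkseqS => ->; congr rcons.
by rewrite nth_rcons size_aut size_mkseq ltnn eqxx.
Qed.

End Boundary.
Arguments boundary d : clear implicits.

Section SymmetricPower.
Context {disp : measure_display} (T : measurableType disp) (n : nat).

Definition sym_rel (x y : n.-tuple T) : bool :=
  [exists p : 'S_n, y == [tuple tnth x (p i) | i < n]].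

Fact sym_relP : equiv_class_of sym_rel.
Proof.
have symE x y : sym_rel x y = perm_eq y x.
  apply/existsP/tuple_permP => -[p e]; exists p; first by rewrite (eqP e).
  by apply/eqP/val_inj; exact: e.
by split=> [x|x y|y x z]; rewrite !symE; [exact: perm_refl|exact: perm_sym|];
  move=> xy yz; exact: perm_trans yz xy.
Qed.

Canonical sym_equiv := EquivRelPack sym_relP.

Definition sym_power : Type := {eq_quot sym_equiv}.

HB.instance Definition _ := Choice.on sym_power.
HB.instance Definition _ := EqQuotient.on sym_power.
HB.instance Definition _ := isPointed.Build sym_power (\pi_sym_power point).

Definition sym_measurable : set (set sym_power) :=
  image_set_system setT \pi_sym_power (@measurable _ (n.-tuple T)).

Fact sym_measurable0 : sym_measurable set0.
Proof. by rewrite /sym_measurable/image_set_system/= preimage_set0 setI0. Qed.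

Fact sym_measurableC A : sym_measurable A -> sym_measurable (~` A).
Proof.
rewrite /sym_measurable/image_set_system/= !setTI -preimage_setC.
exact: measurableC.
Qed.

Fact sym_measurable_bigcup (F : (set sym_power)^nat) :
  (forall i, sym_measurable (F i)) -> sym_measurable (\bigcup_i F i).
Proof.
rewrite /sym_measurable/image_set_system/= setTI preimage_bigcup => mF.
apply: bigcup_measurable => k _; rewrite -[X in measurable X]setTI.
exact: mF.
Qed.

Definition sym_display : measure_display -> measure_display.
Proof. exact. Qed.

HB.instance Definition _ := @isMeasurable.Build (sym_display disp) sym_power
  sym_measurable sym_measurable0 sym_measurableC sym_measurable_bigcup.

Definition sym_pi (x : n.-tuple T) : sym_power := \pi_sym_power x.

Fact measurable_sym_pi : measurable_fun setT sym_pi.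
Proof. by move=> _ B mB. Qed.

HB.instance Definition _ :=
  isMeasurableFun.Build _ _ _ _ sym_pi measurable_sym_pi.

(* The choice of representative is irrelevant, see sym_map_pi. *)
Definition sym_map (f : T -> T) (z : sym_power) : sym_power :=
  sym_pi (map_tuple f (repr z)).

Lemma sym_map_pi (f : T -> T) (x : n.-tuple T) :
  sym_map f (sym_pi x) = sym_pi (map_tuple f x).
Proof.
apply/eqmodP => /=; have /eqmodP/existsP[p /eqP /= e] := reprK (sym_pi x).
apply/existsP; exists p; apply/eqP/eq_from_tnth => i.
by rewrite !tnth_map tnth_ord_tuple {1}e tnth_map tnth_ord_tuple.
Qed.

End SymmetricPower.
Arguments sym_pi {disp T n}.

Section PowerMeasure.
Context {disp : measure_display} (T : measurableType disp) (R : realType).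

Definition tuple_cons n (x : T * n.-tuple T) : n.+1.-tuple T :=
  [the n.+1.-tuple T of x.1 :: x.2].

Fact measurable_tuple_cons n : measurable_fun setT (@tuple_cons n).
Proof. exact: measurable_cons. Qed.

HB.instance Definition _ n :=
  isMeasurableFun.Build _ _ _ _ (@tuple_cons n) (@measurable_tuple_cons n).

Variable mu : probability T R.

Fixpoint power_measure (n : nat) : probability (n.-tuple T) R :=
  match n with
  | 0 => dirac ([tuple] : 0.-tuple T)
  | m.+1 => distribution (mu \x power_measure m)%E (@tuple_cons m)
  end.

Definition sym_measure (n : nat) : probability (sym_power T n) R :=
  distribution (power_measure n) sym_pi.

End PowerMeasure.

Section DiagonalActions.
Context {d : nat} {R : realType}.
Variables (G : groupClosed (tree_aut d)) (mu : probability (boundary d) R).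
Variable n : nat.
Local Open Scope ereal_scope.

Definition diag (g : tree_aut d) :
    sym_power (boundary d) n -> sym_power (boundary d) n :=
  sym_map (boundary_act g).

Definition null_invariant (A : set (sym_power (boundary d) n)) :=
  forall g, g \in G -> sym_measure mu n ((diag g @^-1` A) `+` A) = 0.

(* Ergodic components are classes of sets modulo null sets; this singles out
   all the representatives A of such classes. *)
Definition ergodic_component (A : set (sym_power (boundary d) n)) :=
  [/\ measurable A, 0 < sym_measure mu n A, null_invariant A
    & forall B, measurable B -> B `<=` A -> null_invariant B ->
        sym_measure mu n B = 0 \/ sym_measure mu n (A `\` B) = 0].

Definition component_measure (A B : set (sym_power (boundary d) n)) : R :=
  (fine (sym_measure mu n (B `&` A)) / fine (sym_measure mu n A))%R.

Definition fixed_points (g : tree_aut d) : set (sym_power (boundary d) n) :=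
  [set z | diag g z = z].

Definition component_character (A : set (sym_power (boundary d) n))
    (g : subgroup_type G) : R[i] :=
  ((component_measure A (fixed_points (val g) `&` A))%:C)%C.

End DiagonalActions.

(* Main.v *)
From HB Require Import structures.
From mathcomp Require Import all_boot all_order all_algebra all_fingroup.
From mathcomp Require Import generic_quotient sesquilinear complex.
From mathcomp Require Import all_classical all_reals all_analysis.
From mathcomp Require Import ring lra zify.
Require Import Defs.
Set Implicit Arguments.
Unset Strict Implicit.
Unset Printing Implicit Defensive.
Import Order.TTheory GRing.Theory Num.Theory numFieldNormedType.Exports.
Local Open Scope ring_scope.

(** For a point y of the symmetric power, let supp_m y be the set of vertices of
level m below which y has a point, and let Q be the finite group of permutations
of level m induced by G. In the component A, ergodicity confines supp_m y almost
surely to one orbit of Q, so that it is distributed as the image of a fixed set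
S0 under a uniform element of Q ([level_prob_orbit]). Almost every y consists of
distinct points, and then g fixes y if and only if g fixes supp_m y for all m.
Hence chi g is the decreasing limit, as m grows, of the proportion of the sets
of the orbit that g fixes ([level_prob_cvg]). A limit of normalized permutation
characters is a character.

For indecomposability, positivity of a character c on 1 and on conjugates
x_1, ..., x_N of g bounds the average of the c (x_i^-1 x_j) from below by
|c g|^2 ([character_spread]). If chi is a proper mixture of chi1 and chi2, the
same average for chi is at least |chi g|^2 plus a positive multiple of
|chi1 g - chi2 g|^2. So it suffices to find conjugates of g for which the
average of the chi (x_i^-1 x_j) is arbitrarily close to |chi g|^2
([indecomposable_spread]).

The conjugates by representatives in G of all elements q of Q, for m large, have
this property. The average is at most the probability that two independent
conjugates g^q and g^q' send a given set S of the orbit to the same set. Choose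
k < m such that the probability that g fixes the support on level k is already
close to chi g. Up to small errors, the conjugates either both fix S, which has
probability close to |chi g|^2, or g^q S has below some vertex v of level k a
point while S has none. In that case let r be in the rigid stabilizer of v.
Replacing q by its product with r moves g^q S by r, as r fixes S. All translates
of g^q S by the rigid stabilizer are thus equally likely. There are many of
them, because the orbits of this stabilizer below v on level m have at least
d^m / K elements, where K is the index in G of the rigid stabilizer of level k
([rist_orbit_large], [conj_image_fiber], [conjugate_collisions]). *)

(** * Indecomposability from spreading conjugates *)

Section Criterion.
Local Open Scope sesquilinear_scope.
Context {R : realType} {gT : groupType}.
Implicit Types (chi : gT -> R[i]) (g h : gT).

(** Row vectors are traded for plain families of scalars, so that the families
below can be written by cases on the index. *)
Lemma psdmxE (k : nat) (M : 'M[R[i]]_k) :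
  psdmx M <-> forall u : 'I_k -> R[i], 0 <= \sum_i \sum_j u i * M i j * (u j)^*.
Proof.
have formE (u : 'rV[R[i]]_k) :
    (u *m M *m u ^t*) 0 0 = \sum_i \sum_j u 0 i * M i j * (u 0 j)^*.
  rewrite mxE exchange_big /=; apply: eq_bigr => j _.
  by rewrite !mxE big_distrl.
split=> psd u; last by rewrite formE.
have := psd (\row_i u i); rewrite formE; congr (is_true (0 <= _)).
by under eq_bigr => i _ do under eq_bigr => j _ do rewrite !mxE.
Qed.

(** A sesquilinear form with real values is Hermitian: the form on the
pair (1, g) is tested on the coefficients (1, 1) and (1, i). *)
Lemma characterV chi g : is_character chi -> chi g^-1%g = (chi g)^*.
Proof.
move=> [_ psd chi1].
have quad (u : R[i]) : 0 <= 1 + u * u^* + (chi g^-1%g * u^* + u * chi g).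
  have := psd 2%N (fun i => if i == ord0 then 1%g else g).
  move=> /psdmxE /(_ (fun i => if i == ord0 then 1 else u)).
  rewrite !big_ord_recl !big_ord0 !mxE /= !mulgV !(mul1g, mulg1, invg1) chi1.
  rewrite !(mul1r, mulr1, addr0, conjC1).
  set x := (X in 0 <= X); set y := (X in _ -> 0 <= X).
  suff -> : x = y by [].
  by rewrite /x /y; ring.
have /ger0_real/CrealP := quad 1; have /ger0_real/CrealP := quad 'i.
rewrite !(rmorphD, rmorphM, rmorph1) /= !conjCK !conjCi !mulr1 !mul1r.
set a := chi _; set b := chi g => e1 e2.
have e : ('i * 2%:R) * (a - b^*) = 0 :> R[i].
  transitivity ((1 + - 'i * 'i + (a^* * 'i + - 'i * b^*)) -
     (1 + 'i * - 'i + (a * - 'i + 'i * b)) -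
     'i * ((1 + 1 + (a^* + b^*)) - (1 + 1 + (a + b)))); first by ring.
  by rewrite e1 e2 !subrr mulr0 subr0.
move/eqP: e; rewrite mulf_eq0 mulf_eq0 (negPf (neq0Ci _)) pnatr_eq0 /= subr_eq0.
by move/eqP.
Qed.

(** Positivity on the family 1, (x 0)^-1, (x 1)^-1, ... with coefficient 1 on each
(x i)^-1 and - N * (chi g)^* on 1: this is the squared norm of
\sum_i (x i)^-1 minus its projection onto 1 in the representation of chi. *)
Lemma character_spread chi g (N : nat) (x : 'I_N -> gT) :
    is_character chi -> (forall i, chi (x i) = chi g) ->
  `|chi g| ^+ 2 * N%:R ^+ 2 <= \sum_i \sum_j chi ((x i)^-1 * x j)%g.
Proof.
move=> chiP xg; have [_ psd chi1] := chiP.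
pose y (i : 'I_N.+1) := if unlift ord0 i is Some j then (x j)^-1%g else 1%g.
pose u (i : 'I_N.+1) : R[i] :=
  if unlift ord0 i is Some j then 1 else - N%:R * (chi g)^*.
have /psdmxE /(_ u) := psd _ y; rewrite big_ord_recl.
under eq_bigr => j _ do rewrite !mxE.
rewrite big_ord_recl /y /u unlift_none invg1 mulg1 chi1.
under eq_bigr => j _ do rewrite liftK invgK mul1g xg rmorph1.
rewrite sumr_const card_ord.
under [X in _ + X]eq_bigr => i _.
  rewrite big_ord_recl !mxE unlift_none liftK invg1 mulg1 characterV // xg.
  under eq_bigr => j _ do rewrite !mxE !liftK invgK mul1r rmorph1 mulr1.
  over.
rewrite big_split /= sumr_const card_ord !rmorphM !rmorphN /= conjCK conjC_nat.
rewrite normCK -(subr_ge0 (_ * _)); set z := chi g.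
by move=> /le_trans; apply; rewrite le_eqVlt; apply/predU1P; left; ring.
Qed.

(** If chi is a mixture of chi1 and chi2 with weights a and 1 - a, each chi_t obeys
[character_spread] for the same conjugates of g. The mixture of these two lower
bounds exceeds |chi g|^2 by a (1 - a) |chi1 g - chi2 g|^2, by strict convexity
of the squared modulus, and the hypothesis leaves no room for such an excess.
In the representation of chi the hypothesis says that averages of conjugates
of g come arbitrarily close to the scalar chi g. *)
Lemma indecomposable_spread chi :
  (forall g (e : R), 0 < e -> exists N (x : 'I_N -> gT),
     (0 < N)%N /\ (forall i, exists h, x i = h * g * h^-1)%g /\
     \sum_i \sum_j chi ((x i)^-1 * x j)%g <=
       (`|chi g| ^+ 2 + e%:C%C) * N%:R ^+ 2) ->
  indecomposable chi.
Proof.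
move=> spread [a [chi1 [chi2 [/andP[a0 a1] c1 c2 + chiE]]]]; apply.
apply/funext => g; apply/subr0_eq/eqP; rewrite -normr_eq0 -sqrf_eq0.
have a01 : 0 < a * (1 - a) by rewrite mulr_gt0 ?subr_gt0.
suff le_e (e : R) : 0 < e -> `|chi1 g - chi2 g| ^+ 2 <= e%:C%C.
  have z0 : 0 <= `|chi1 g - chi2 g| ^+ 2 by rewrite exprn_ge0.
  have := RRe_real (ger0_real z0); move: (complex.Re _) => r rE.
  move: z0 le_e; rewrite -rE lecR => z0 le_e.
  rewrite -(rmorph0 (real_complex R)) (inj_eq (@complexI _)) eq_le z0 andbT.
  by apply/ler_addgt0Pr => e e0; rewrite add0r -lecR; exact: le_e.
move=> e0; have [N [x [N_gt0 [xg]]]] := spread g _ (mulr_gt0 e0 a01).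
set N2 := N%:R ^+ 2; have N0 : 0 < N2 by rewrite exprn_gt0 ?ltr0n.
have xc (c : gT -> R[i]) : is_character c -> forall i, c (x i) = c g.
  by move=> [cc _ _] i; have [h ->] := xg i; rewrite cc !mulgA mulVg mul1g.
have := character_spread c1 (xc _ c1); have := character_spread c2 (xc _ c2).
rewrite -/N2.
set S2 := \sum_i _ => le2; set S1 := \sum_i _ => le1.
have -> : \sum_i \sum_j chi ((x i)^-1 * x j)%g = a%:C%C * S1 + (1 - a)%:C%C * S2.
  rewrite !mulr_sumr -big_split; apply: eq_bigr => i _ /=.
  by rewrite !mulr_sumr -big_split; apply: eq_bigr => j _ /=; exact: chiE.
rewrite chiE => le12.
have aC : (a%:C%C)^* = a%:C%C :> R[i] by exact: conjc_real.
have aC0 : 0 <= a%:C%C :> R[i] by rewrite lecR ltW.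
have bC0 : 0 <= (1 - a)%:C%C :> R[i] by rewrite lecR subr_ge0 ltW.
have := le_trans (lerD (ler_wpM2l aC0 le1) (ler_wpM2l bC0 le2)) le12.
rewrite !normCK rmorphM rmorphB rmorph1 !(rmorphD, rmorphM, rmorphB, rmorph1) /= aC.
set b := a%:C%C; set u := chi1 g; set v := chi2 g; set f := e%:C%C.
rewrite !rmorphN /= aC -/b => le12'.
(* After division by this factor the inequality is the excess in the convexity
   of the squared modulus. *)
have w0 : 0 < b * (1 - b) * N2.
  by rewrite mulr_gt0 // /b -(rmorph1 (real_complex R)) -rmorphB -rmorphM ltcR.
rewrite -(ler_pM2l w0) -subr_ge0; move: le12'; rewrite -subr_ge0.
by move=> /le_trans; apply; rewrite le_eqVlt; apply/predU1P; left; ring.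
Qed.

End Criterion.

(** * Collisions of conjugates in a finite permutation group *)

Section ConjugateImages.
Local Open Scope nat_scope.
Local Open Scope group_scope.
Context {T : finType}.
Implicit Types (Q R : {group {perm T}}) (s : {perm T}) (A B : {set T}).

Definition perm_image s A : {set T} := s @: A.

Lemma mem_perm_image s A x : x \in A -> s x \in perm_image s A.
Proof. exact: imset_f. Qed.

Lemma perm_imageM s t A : perm_image (s * t) A = perm_image t (perm_image s A).
Proof.
by rewrite /perm_image -imset_comp; apply: eq_imset => x; rewrite /= permM.
Qed.

Lemma perm_image1 A : perm_image 1 A = A.
Proof.
by rewrite -[RHS]imset_id; apply: eq_imset => x; rewrite perm1.
Qed.

Lemma perm_imageK s : cancel (perm_image s) (perm_image s^-1).
Proof. by move=> A; rewrite -perm_imageM mulgV perm_image1. Qed.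

Lemma perm_imageVK s : cancel (perm_image s^-1) (perm_image s).
Proof. by move=> A; rewrite -perm_imageM mulVg perm_image1. Qed.

Lemma perm_image_inj s : injective (perm_image s).
Proof. exact: can_inj (perm_imageK s). Qed.

Lemma card_perm_image s A : #|perm_image s A| = #|A|.
Proof. exact/card_imset/perm.perm_inj. Qed.

(** For r in R, multiplying q by r on the right leaves A alone and moves the
image of A under s ^ q by r. The fibers over the R-translates of B therefore
all have at least as many elements as the fiber over B, and they are disjoint.
There are at least #|R u| / #|B| translates, since together they cover R u. *)
Lemma conj_image_fiber Q R s A B (u : T) :
    R \subset Q -> (forall r, r \in R -> perm_image r A = A) -> u \in B ->
  #|[set (r : {perm T}) u | r in R]| * #|[set q in Q | perm_image (s ^ q) A == B]|
    <= #|B| * #|Q|.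
Proof.
move=> sRQ fixA uB; set fiber := fun C => [set q in Q | perm_image (s ^ q) A == C].
pose O := [set perm_image r B | r in R].
have orbitO : #|[set (r : {perm T}) u | r in R]| <= #|B| * #|O|.
  have sub : [set (r : {perm T}) u | r in R] \subset finset.cover O.
    apply/fintype.subsetP => _ /imsetP[r rR ->]; apply/bigcupP.
    by exists (perm_image r B); [exact: imset_f | exact: mem_perm_image].
  apply: leq_trans (subset_leq_card sub) _.
  apply: leq_trans (leq_card_cover O) _; rewrite mulnC -sum_nat_const.
  by apply: leq_sum => _ /imsetP[r _ ->]; rewrite card_perm_image.
have fiberO : #|O| * #|fiber B| <= #|Q|.
  rewrite -sum_nat_const; apply: (@leq_trans (\sum_(C in O) #|fiber C|)).
    apply: leq_sum => _ /imsetP[r rR ->].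
    rewrite -(card_imset (fiber B) (mulIg r)); apply: subset_leq_card.
    apply/fintype.subsetP => _ /imsetP[q + ->]; rewrite !inE => /andP[qQ /eqP <-].
    rewrite (groupM qQ (fintype.subsetP sRQ _ rR)) /= /conjg invMg.
    by rewrite !mulgA !perm_imageM (fixA r^-1) ?groupV.
  apply: (@leq_trans #|[set q in Q | perm_image (s ^ q) A \in O]|); last first.
    by apply: subset_leq_card; apply/fintype.subsetP => q; rewrite inE => /andP[].
  rewrite -[leqRHS]sum1_card.
  rewrite (partition_big (fun q => perm_image (s ^ q) A) (mem O)) /=; last first.
    by move=> q; rewrite inE => /andP[].
  apply: leq_sum => C CO; rewrite -sum1_card.
  rewrite [leqLHS](eq_bigl (fun q =>
    (q \in [set q in Q | perm_image (s ^ q) A \in O])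
      && (perm_image (s ^ q) A == C))) // => q.
  rewrite !inE -andbA; case: eqP => [->|]; last by rewrite !andbF.
  by rewrite CO !andbT.
apply: leq_trans (leq_mul orbitO (leqnn _)) _.
by rewrite -mulnA leq_mul2l fiberO orbT.
Qed.

End ConjugateImages.

Lemma card_reindex (T : finType) (D : {set T}) (f : pred T) (phi : T -> T) :
    injective phi -> (forall x, (phi x \in D) = (x \in D)) ->
  #|[set x in D | f (phi x)]| = #|[set x in D | f x]|.
Proof.
move=> phi_inj phiD; rewrite -!sum1_card [RHS](reindex_inj phi_inj).
by apply: eq_bigl => x; rewrite !inE phiD.
Qed.

(** Collisions are counted by the value of F i: the value j, the other values
satisfying P, and the values violating P, whose fibers are small. *)
Lemma collisions_bound (I J : finType) (D : {set I}) (F : I -> J) (P : pred J)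
    (j : J) (a b c L : nat) :
    #|[set i in D | F i == j]| = a ->
    #|[set i in D | P (F i) && (F i != j)]| = b ->
    (forall i, i \in D -> ~~ P (F i) ->
       L * #|[set k in D | F k == F i]| <= c * #|D|)%N ->
  (L * (\sum_(i in D) \sum_(k in D) (F k == F i)) <=
     L * (a * a + b * #|D|) + c * #|D| * #|D|)%N.
Proof.
move=> <- <- fiber.
have cardE (p : pred I) : #|[set i in D | p i]| = (\sum_(i in D) p i)%N.
  rewrite -sum1_card big_mkcond [RHS]big_mkcond; apply: eq_bigr => i _ /=.
  by rewrite inE; case: (i \in D); case: (p i).
rewrite big_distrr /=.
apply: (@leq_trans (\sum_(i in D) (L * ((F i == j) * #|[set i in D | F i == j]|
    + (P (F i) && (F i != j)) * #|D|) + c * #|D|)))%N; last first.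
  rewrite big_split /= -big_distrr /= big_split /= -!big_distrl /=.
  by rewrite -!cardE sum_nat_const (mulnC #|D| c).
apply: leq_sum => i iD; rewrite -cardE.
have [Pi|Pi] := boolP (P (F i)); last first.
  by apply: leq_trans (fiber _ iD Pi) (leq_addl _ _).
apply: leq_trans (leq_addr _ _); rewrite leq_mul2l; apply/orP; right.
have [<-|ne] := eqVneq (F i) j; first by rewrite mul1n leq_addr.
rewrite mul0n mul1n add0n; apply: subset_leq_card.
by apply/fintype.subsetP => k; rewrite inE => /andP[].
Qed.

(** * The action on a level and the orbits of rigid stabilizers *)

Section Levels.
Context {d : nat}.
Implicit Types (g h : tree_aut d) (k m : nat).

Lemma aut_take g (u : vertex d) k : take k (g u) = g (take k u).
Proof.
elim/last_ind: u => [|u a IHu]; first by rewrite aut_root.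
have [b gb] := aut_rcons g u a.
have [ku|ku] := leqP k (size u).
  by rewrite gb -!cats1 !takel_cat ?size_aut // IHu.
by rewrite !take_oversize ?size_aut ?size_rcons.
Qed.

Definition level_act m g (t : m.-tuple (letter d)) : m.-tuple (letter d) :=
  @Tuple m _ (g t) (introT eqP (etrans (size_aut g t) (size_tuple t))).

Lemma level_act_inj m g : injective (@level_act m g).
Proof.
move=> s t /(congr1 val) /= /(can_inj (@aut_funK _ g)); exact: val_inj.
Qed.

(** A homomorphism only up to reversal, see [level_permM]: automorphisms of the
tree compose from right to left, permutations from left to right. *)
Definition level_perm m g : {perm m.-tuple (letter d)} :=
  perm (@level_act_inj m g).

Lemma level_permE m g (t : m.-tuple (letter d)) :
  level_perm m g t = g t :> vertex d.
Proof. by rewrite permE. Qed.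

Lemma level_permM m g h :
  level_perm m (g * h)%g = (level_perm m h * level_perm m g)%g.
Proof. by apply/permP => t; apply: val_inj; rewrite /= permM !level_permE. Qed.

Lemma level_perm1 m : level_perm m 1%g = 1%g.
Proof. by apply/permP => t; apply: val_inj; rewrite /= perm1 level_permE. Qed.

Lemma level_permV m g : level_perm m g^-1%g = (level_perm m g)^-1%g.
Proof. by apply/eqP; rewrite eq_sym eq_invg_mul -level_permM mulVg level_perm1. Qed.

(** Padding by a default letter makes this total; it is the prefix of length k
when k <= m. *)
Definition truncation k m (t : m.-tuple (letter d)) : k.-tuple (letter d) :=
  [tuple of mkseq (nth ord0 t) k].

Lemma truncationE k m (t : m.-tuple (letter d)) : (k <= m)%N ->
  truncation k t = take k t :> vertex d.
Proof.
move=> km; apply: (@eq_from_nth _ ord0); rewrite size_mkseq ?size_takel ?size_tuple //.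
by move=> i ik; rewrite nth_mkseq // nth_take.
Qed.

Lemma truncation_level_perm k m g (t : m.-tuple (letter d)) : (k <= m)%N ->
  truncation k (level_perm m g t) = level_perm k g (truncation k t).
Proof.
move=> km; apply: val_inj; transitivity (take k (level_perm m g t)).
  exact: truncationE.
by rewrite level_permE aut_take -truncationE // -level_permE.
Qed.

Lemma prefix_truncation k m (v : k.-tuple (letter d)) (t : m.-tuple (letter d)) :
  (k <= m)%N -> prefix v t = (truncation k t == v).
Proof.
by move=> km; rewrite prefixE size_tuple -truncationE.
Qed.

Definition level_image (H : set (tree_aut d)) m : {set {perm m.-tuple (letter d)}} :=
  [set q | `[< exists2 g, H g & level_perm m g = q >]].

Lemma level_imageP (H : set (tree_aut d)) m q :
  reflect (exists2 g, H g & level_perm m g = q) (q \in level_image H m).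
Proof. by rewrite inE; exact: asboolP. Qed.

Lemma level_image_group_set (H : set (tree_aut d)) m :
    H 1%g -> (forall g h, H g -> H h -> H (g * h)%g) ->
  group_set (level_image H m).
Proof.
move=> H1 HM; apply/group_setP; split.
  by apply/level_imageP; exists 1%g => //; exact: level_perm1.
move=> _ _ /level_imageP[g Hg <-] /level_imageP[h Hh <-].
by apply/level_imageP; exists (h * g)%g; [exact: HM|rewrite level_permM].
Qed.

Section Branch.
Variable G : groupClosed (tree_aut d).

Let G1 : [set` G]%classic 1%g. Proof. exact: gpred1. Qed.

Let GM g h : ([set` G]%classic g : Prop) -> [set` G]%classic h ->
  [set` G]%classic (g * h)%g.
Proof. exact: gpredM. Qed.

Definition level_group m : {group {perm m.-tuple (letter d)}} :=
  Group (level_image_group_set m G1 GM).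

Lemma rist_fixed (v w : vertex d) r : rist G v r -> ~~ prefix v w -> r w = w.
Proof. by move=> [_]; apply. Qed.

Lemma rist1 (v : vertex d) : rist G v 1%g.
Proof. by split=> //; exact: gpred1. Qed.

Lemma ristM (v : vertex d) r s : rist G v r -> rist G v s -> rist G v (r * s)%g.
Proof.
move=> [rG rfix] [sG sfix]; split=> [|w vw]; first exact: gpredM.
by rewrite -[RHS](rfix w) // -[in RHS](sfix w).
Qed.

Lemma ristV (v : vertex d) r : rist G v r -> rist G v r^-1%g.
Proof.
move=> [rG rfix]; split=> [|w vw]; first by rewrite gpredV.
by rewrite -[in LHS](rfix w) //= aut_funK.
Qed.

Definition rist_group (v : vertex d) m : {group {perm m.-tuple (letter d)}} :=
  Group (level_image_group_set m (rist1 v) (@ristM v)).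

Lemma rist_prefix (v w : vertex d) r : rist G v r -> prefix v (r w) = prefix v w.
Proof.
move=> rv; apply/idP/idP; apply: contraLR => vw.
  by rewrite (rist_fixed rv).
have : r^-1%g (r w) = r w by apply: rist_fixed vw; exact: ristV.
by rewrite /= aut_funK => ->.
Qed.

(** The elements that agree below each vertex of level k with an element of its
rigid stabilizer form a group, and it contains every rigid stabilizer of
level k, because those of other vertices are trivial below v. *)
Lemma level_rist_below k h (v : vertex d) : level_rist G k h -> size v = k ->
  exists2 r, rist G v r & forall u, prefix v u -> h u = r u.
Proof.
move=> hN vk; pose H : set (tree_aut d) := fun h =>
  exists2 r, rist G v r & forall u, prefix v u -> h u = r u.
suff /(_ h hN) : (level_rist G k `<=` H)%classic by [].
apply: smallest_sub; first split.
- by rewrite inE; exists 1%g => //; exact: rist1.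
- move=> g1 g2; rewrite !inE => -[r1 rv1 e1] [r2 rv2 e2].
  exists (r1 * r2^-1)%g; first exact/ristM/ristV.
  move=> u vu /=; have vu2 : prefix v (r2^-1%g u).
    by rewrite (rist_prefix _ (ristV rv2)).
  suff -> : aut_inv g2 u = r2^-1%g u by rewrite e1.
  by rewrite -[u in LHS](aut_invK r2) -e2 // aut_funK.
- move=> g [w /= wk gw]; have [wv|wv] := eqVneq w v.
    by exists g => //; rewrite -wv.
  exists 1%g; first exact: rist1.
  move=> u vu /=; apply: (rist_fixed gw); apply: contra wv => wu.
  by move: wu vu; rewrite !prefixE wk vk => /eqP <- /eqP <-.
Qed.

(** The group G moves u to all d ^ m vertices of its level, and it is a union of
finitely many cosets of [level_rist G k]. Each coset moves u to as many vertices
as [level_rist G k] does, hence by [level_rist_below] as many as the rigid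
stabilizer of v alone. So this number is at least d ^ m divided by the index. *)
Lemma rist_orbit_large k L : (2 <= d)%N -> is_branch G ->
  exists2 m, (k <= m)%N &
    forall (v : k.-tuple (letter d)) (u : m.-tuple (letter d)),
      truncation k u = v ->
      (L <= #|[set (r : {perm _}) u | r in rist_group v m]|)%N.
Proof.
move=> d2 [trans /(_ k) /finite_seqP[cosets cosetsE]].
(* size cosets * L <= m < d ^ m, so the index times L is at most d ^ m. *)
pose m := maxn k (size cosets * L); exists m; first exact: leq_maxl.
move=> v u uv; set orb := [set _ | _ in _].
pose im (C : set (tree_aut d)) : {set m.-tuple (letter d)} :=
  [set w | `[< exists2 g, C g & level_perm m g u = w >]].
have imC C : C \in cosets -> (#|im C| <= #|orb|)%N.
  move=> Cc; have : [set` cosets]%classic C by [].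
  rewrite -cosetsE => -[g gG <-].
  rewrite -(card_imset (mem orb) (@perm.perm_inj _ (level_perm m g))).
  apply/subset_leq_card/fintype.subsetP => w; rewrite inE => /asboolP[_ [h hN <-] <-].
  have [r rv hr] := level_rist_below hN (size_tuple v).
  rewrite level_permM permM; apply: imset_f.
  apply/imsetP; exists (level_perm m r); first by apply/level_imageP; exists r.
  apply: val_inj; rewrite /= !level_permE hr //.
  by rewrite (prefix_truncation _ _ (leq_maxl _ _)) uv.
have cover : (#|{: m.-tuple (letter d)}| <= \sum_(C <- cosets) #|im C|)%N.
  rewrite -sum1_card; under [leqRHS]eq_bigr => C _ do rewrite -sum1_card big_mkcond.
  rewrite exchange_big /=; apply: leq_sum => w _.
  have [g gG gu] := trans m u w (size_tuple u) (size_tuple w).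
  have gc : [set (g * h)%g | h in level_rist G k]%classic \in cosets.
    suff : [set` cosets]%classic [set (g * h)%g | h in level_rist G k]%classic by [].
    by rewrite -cosetsE; exists g.
  rewrite (big_rem _ gc) /= ifT // inE; apply/asboolP; exists g.
    by exists 1%g; [|exact: mulg1] => H [[H1 _] _]; rewrite inE in H1.
  by apply: val_inj; rewrite /= level_permE.
have size_gt0 : (0 < size cosets)%N.
  case: (cosets) cover => //; rewrite big_nil leqn0 => /eqP/card0_eq/(_ u).
  by rewrite inE.
rewrite -(leq_pmul2l size_gt0); apply: (@leq_trans m); first exact: leq_maxr.
apply: (@leq_trans #|{: m.-tuple (letter d)}|).
  rewrite card_tuple card_ord; apply: ltnW; apply: ltn_expl.
  by case: d d2 => [|[]].
apply: leq_trans cover _; rewrite big_seq.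
apply: (@leq_trans (\sum_(C <- cosets | C \in cosets) #|orb|)%N); first exact: leq_sum.
by rewrite -big_seq big_const_seq count_predT iter_addn_0 mulnC.
Qed.

End Branch.

End Levels.

(** * Collisions of conjugates on a level *)

Section FixedSets.
Context {d : nat}.
Implicit Types g h : tree_aut d.

Definition fixes m g (S : {set m.-tuple (letter d)}) : bool :=
  perm_image (level_perm m g) S == S.

Definition truncate k m (S : {set m.-tuple (letter d)}) : {set k.-tuple (letter d)} :=
  [set truncation k t | t in S].

Lemma truncate_level_perm k m g (S : {set m.-tuple (letter d)}) : (k <= m)%N ->
  truncate k (perm_image (level_perm m g) S) =
    perm_image (level_perm k g) (truncate k S).
Proof.
move=> km; rewrite /perm_image /truncate -!imset_comp; apply: eq_imset => t /=.
by rewrite truncation_level_perm.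
Qed.

Lemma level_perm_conj m g h :
  level_perm m (h * g * h^-1)%g = (level_perm m g ^ level_perm m h)%g.
Proof. by rewrite !level_permM level_permV /conjg mulgA. Qed.

Lemma conj_fixes m g h (S : {set m.-tuple (letter d)}) :
  fixes (h * g * h^-1)%g S = fixes g (perm_image (level_perm m h)^-1%g S).
Proof.
rewrite /fixes -[RHS](inj_eq (@perm_image_inj _ (level_perm m h))) perm_imageVK.
by rewrite level_perm_conj /conjg !perm_imageM.
Qed.

Variable G : groupClosed (tree_aut d).

(** With S fixed and q, q' ranging over the image of G on level m, the conjugates
of g by q and q' seldom send S to the same set. Either both send S to itself
(a * a pairs), or one moves S but not its truncation to level k (at most c - a
choices of q), or the image B of S has a vertex v of level k that S does not
have. In the last case the rigid stabilizer of v fixes S and has large orbits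
below v, so [conj_image_fiber] makes B one of many equally likely images. *)
Lemma conjugate_collisions k m L g (S : {set m.-tuple (letter d)}) (a c : nat) :
    g \in G -> (k <= m)%N ->
    (forall (v : k.-tuple (letter d)) (u : m.-tuple (letter d)),
      truncation k u = v ->
      (L <= #|[set (r : {perm _}) u | r in rist_group G v m]|)%N) ->
    #|[set q in level_group G m | fixes g (perm_image q^-1%g S)]| = a ->
    #|[set q in level_group G m | fixes g (truncate k (perm_image q^-1%g S))]| = c ->
  (L * (\sum_(q in level_group G m) \sum_(q' in level_group G m)
     (perm_image (level_perm m g ^ q')%g S == perm_image (level_perm m g ^ q)%g S)) <=
    L * (a * a + (c - a) * #|level_group G m|)
      + #|S| * #|level_group G m| * #|level_group G m|)%N.
Proof.
move=> gG km orb; set Q := level_group G m => aE cE.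
pose F q := perm_image (level_perm m g ^ q)%g S.
have lift q : q \in Q -> exists2 h, h \in G & level_perm m h = q.
  by move=> /level_imageP[h hG hq]; exists h.
pose same (B : {set m.-tuple (letter d)}) := truncate k B == truncate k S.
have aF : #|[set q in Q | F q == S]| = a.
  rewrite -aE; apply: eq_card => q; rewrite [LHS]inE [RHS]inE.
  apply: andb_id2l => /lift[h hG <-].
  by rewrite -conj_fixes /fixes level_perm_conj.
have cF : #|[set q in Q | same (F q)]| = c.
  rewrite -cE; apply: eq_card => q; rewrite [LHS]inE [RHS]inE.
  apply: andb_id2l => /lift[h hG <-].
  rewrite /F -level_perm_conj /same truncate_level_perm // -level_permV.
  by rewrite truncate_level_perm // level_permV -conj_fixes.
apply: (@collisions_bound _ _ Q F same S) => //.
  rewrite -aF -cF -cardsDS; last first.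
    apply/fintype.subsetP => q; rewrite finset.in_set => /andP[qQ /eqP FS].
    by rewrite finset.in_set qQ /same FS /=.
  apply: eq_card => q; rewrite finset.in_set finset.in_setD finset.in_set finset.in_set.
  by case: (q \in Q); rewrite //= andbC.
move=> q qQ diff.
have [h hG hq] := lift q qQ.
have FqE : F q = perm_image (level_perm m (h * g * h^-1)%g) S.
  by rewrite level_perm_conj hq.
have cardFq : #|truncate k (F q)| = #|truncate k S|.
  by rewrite FqE truncate_level_perm // card_perm_image.
(* Distinct sets of the same size: one has a vertex v outside the other. *)
have /subsetPn[_ /imsetP[u uF ->] vS] : ~~ (truncate k (F q) \subset truncate k S).
  by apply: contra diff => sub; rewrite /same eqEcard sub cardFq leqnn.
set v := truncation k u in vS.
apply: leq_trans (leq_mul (orb v u erefl) (leqnn _)) _.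
have -> : #|S| = #|F q| by rewrite card_perm_image.
apply: conj_image_fiber => //.
- apply/fintype.subsetP => _ /level_imageP[r [rG _] <-].
  by apply/level_imageP; exists r.
- move=> _ /level_imageP[r rv <-].
  rewrite -[RHS]imset_id; apply: eq_in_imset => t tS; apply: val_inj.
  rewrite /= level_permE; apply: (rist_fixed rv); rewrite prefix_truncation //.
  by apply: contra vS => /eqP <-; exact: imset_f.
Qed.

End FixedSets.

Local Open Scope classical_set_scope.

(** * The power measure and its finite levels *)

Section PowerInvariance.
Context {disp : measure_display} {T : measurableType disp} {R : realType}.
Variables (mu : probability T R) (f : T -> T).
Hypothesis mf : measurable_fun setT f.
Hypothesis f_invariant : forall B, measurable B -> mu (f @^-1` B) = mu B.

Lemma measurable_map_tuple n :
  measurable_fun setT (map_tuple f : n.-tuple T -> n.-tuple T).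
Proof.
apply/measurable_fun_tnthP => i.
have -> : (tnth (T:=T))^~ i \o map_tuple f = f \o (tnth (T:=T))^~ i.
  by apply/funext => x; rewrite /= tnth_map.
by apply: measurableT_comp => //; exact: measurable_tnth.
Qed.

(** By induction: the section over x of the preimage of B under map_tuple f is
the preimage of the section of B over f x. *)
Lemma power_measure_invariant n (B : set (n.-tuple T)) : measurable B ->
  power_measure mu n (map_tuple f @^-1` B) = power_measure mu n B.
Proof.
elim: n B => [|n IHn] B mB.
  congr (_ _); apply/seteqP.
  by split=> x; rewrite /= (tuple0 x) ?(tuple0 (map_tuple f _)).
set C := tuple_cons (n:=n) @^-1` B.
have mC : measurable C.
  by rewrite -[X in measurable X]setTI; exact: measurable_tuple_cons.
rewrite /= /distribution /pushforward /= /product_measure1.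
transitivity (\int[mu]_x ((power_measure mu n \o xsection C) \o f) x)%E.
  apply: eq_integral => x _ /=.
  rewrite -[RHS]IHn; last exact: measurable_xsection.
  congr (_ _); apply/seteqP.
  have e y : map_tuple f (tuple_cons (x, y)) = tuple_cons (f x, map_tuple f y).
    exact: val_inj.
  by split=> y; rewrite /xsection /= !inE /C /= e.
rewrite -[X in integral _ X](preimage_setT f) -ge0_integral_pushforward //;
  last exact: measurable_fun_xsection.
by apply: eq_measure_integral => D mD _; exact: f_invariant.
Qed.

End PowerInvariance.

Section Labels.
Context {disp : measure_display} {T : measurableType disp} {R : realType}.
Variables (I : finType) (L : T -> I).
Hypothesis mL : forall i, measurable [set x | L x = i].

Lemma measurable_label (p : pred I) : measurable [set x | p (L x)].
Proof.
rewrite (_ : [set x | _] = \bigcup_(i in [set` p]) [set x | L x = i]).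
  by apply: fin_bigcup_measurable => //; exact: finite_finset.
by apply/seteqP; split=> [x px|x [i pi /= ->]//]; exists (L x).
Qed.

Lemma measure_label_sum (mu : {measure set T -> \bar R}) (A : set T) (p : pred I) :
    measurable A ->
  mu (A `&` [set x | p (L x)]) =
    (\sum_(i | p i) mu (A `&` [set x | L x = i]))%E.
Proof.
move=> mA; rewrite -big_filter.
have pE : p =1 mem [seq i <- index_enum I | p i].
  by move=> i; rewrite /= mem_filter mem_index_enum andbT.
under eq_set => x do rewrite pE.
have := filter_uniq p (index_enum_uniq I).
elim: [seq _ <- _ | _] => [_|i s IHs /andP[si us]].
  rewrite big_nil (_ : _ `&` _ = set0) ?measure0 //.
  by apply/seteqP; split=> // x [].
rewrite big_cons -IHs // -measureU.
- congr (mu _); rewrite -setIUr; congr (A `&` _).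
  apply/seteqP; split=> x /=; rewrite inE.
    by case/predU1P; [left|right].
  by case=> [->|->]; rewrite ?eqxx ?orbT.
- exact: measurableI.
- by apply: measurableI => //; exact: measurable_label.
- apply/seteqP; split=> // x [[_ /= ->] [_ /=]].
  by rewrite (negPf si).
Qed.

End Labels.

Lemma le_measure_bigsetU disp (T : measurableType disp) (R : realType)
    (mu : {measure set T -> \bar R}) (I : Type) (s : seq I) (F : I -> set T)
    (B : set T) :
  (forall i, measurable (F i)) -> measurable B ->
  B `<=` \big[setU/set0]_(i <- s) F i -> (mu B <= \sum_(i <- s) mu (F i))%E.
Proof.
move=> mF mB BF; apply: (@le_trans _ _ (mu (\big[setU/set0]_(i <- s) F i))).
  by apply: le_measure; rewrite ?inE //; exact: bigsetU_measurable.
elim: s {BF} => [|i s IHs]; first by rewrite !big_nil measure0.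
rewrite !big_cons; apply: le_trans (measureU2 _ _ _) _ => //.
  exact: bigsetU_measurable.
exact: leeD2l.
Qed.

Section BoundaryLevels.
Context {d : nat} {R : realType}.

Lemma measurable_cylinder (v : vertex d) : measurable (cylinder v : set (boundary d)).
Proof. by apply: sub_sigma_algebra; exists v. Qed.

Definition point_prefix m (x : boundary d) : m.-tuple (letter d) :=
  [tuple of mkseq x m].

Definition level_label m n (x : n.-tuple (boundary d)) :
    n.-tuple (m.-tuple (letter d)) :=
  map_tuple (point_prefix m) x.

Lemma point_prefix_cylinder m (x : boundary d) (t : m.-tuple (letter d)) :
  point_prefix m x = t <-> cylinder t x.
Proof.
rewrite /cylinder /= size_tuple; split=> [<- //|e]; exact: val_inj.
Qed.

(** Every event decided by the prefixes of length m of the n points is measurable;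
all the events below are of this form or countable combinations of such. *)
Lemma measurable_level_fiber m n (s : n.-tuple (m.-tuple (letter d))) :
  measurable [set x : n.-tuple (boundary d) | level_label m x = s].
Proof.
rewrite (_ : [set x | _] = \bigcap_(i in [set: 'I_n])
    ((fun x : n.-tuple (boundary d) => tnth x i) @^-1` cylinder (tnth s i))).
  apply: fin_bigcap_measurable => // i _.
  rewrite -[X in measurable X]setTI; apply: measurable_tnth => //.
  exact: measurable_cylinder.
apply/seteqP; split=> x /=.
  by move=> xs i _ /=; apply/point_prefix_cylinder; rewrite -xs tnth_map.
move=> xs; apply: eq_from_tnth => i; rewrite tnth_map.
exact/point_prefix_cylinder/xs.
Qed.

Lemma measurable_level m n (p : pred (n.-tuple (m.-tuple (letter d)))) :
  measurable [set x : n.-tuple (boundary d) | p (level_label m x)].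
Proof. exact: (measurable_label (@measurable_level_fiber m n)). Qed.

Section Collisions.
Variable mu : probability (boundary d) R.
Hypothesis mu_cylinder : forall v : vertex d,
  mu (cylinder v) = (d%:R ^- size v)%:E.
Variable m : nat.

Lemma power_measureS n (B : set (n.+1.-tuple (boundary d))) :
  power_measure mu n.+1 B =
  (mu \x power_measure mu n)%E (@tuple_cons _ (boundary d) n @^-1` B).
Proof. by []. Qed.

Lemma measurable_consT n (B : set (n.+1.-tuple (boundary d))) :
  measurable B -> measurable (@tuple_cons _ (boundary d) n @^-1` B).
Proof.
by move=> mB; rewrite -[X in measurable X]setTI; exact: measurable_tuple_cons.
Qed.

Let measurable_hit n (t : m.-tuple (letter d)) :
  measurable [set x : n.-tuple (boundary d) | t \in level_label m x].
Proof. exact: (measurable_level (fun s : n.-tuple _ => t \in s)). Qed.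

Let measurable_dup n :
  measurable [set x : n.-tuple (boundary d) | ~~ uniq (level_label m x)].
Proof. exact: (measurable_level (fun s : n.-tuple _ => ~~ uniq s)). Qed.

Lemma power_measure_hit n (t : m.-tuple (letter d)) :
  (power_measure mu n [set x | t \in level_label m x] <= (n%:R * d%:R ^- m)%:E)%E.
Proof.
elim: n => [|n IHn].
  rewrite mul0r (_ : [set x | _] = set0) ?measure0 //.
  by apply/seteqP; split=> // x; rewrite /= tuple0.
rewrite power_measureS.
set H := [set x : n.-tuple (boundary d) | t \in level_label m x] in IHn *.
have mH : measurable H by exact: measurable_hit.
pose C : set (boundary d * n.-tuple (boundary d)) :=
  cylinder t `*` [set: n.-tuple (boundary d)].
pose D : set (boundary d * n.-tuple (boundary d)) := [set: boundary d] `*` H.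
have mC : measurable C by apply: measurableX => //; exact: measurable_cylinder.
have mD : measurable D by exact: measurableX.
apply: (@le_trans _ _ ((mu \x power_measure mu n)%E (C `|` D))).
  apply: le_measure; rewrite ?inE.
  - by apply: measurable_consT; exact: measurable_hit.
  - exact: measurableU.
  - move=> [x y] /=; rewrite inE => /predU1P[/esym/point_prefix_cylinder xt|yt].
      by left.
    by right.
apply: le_trans (measureU2 _ mC mD) _.
rewrite [X in (X + _)%E](_ : _ = mu (cylinder t) * power_measure mu n setT)%E;
  last by apply: product_measure1E => //; exact: measurable_cylinder.
rewrite [X in (_ + X)%E](_ : _ = mu setT * power_measure mu n H)%E;
  last exact: product_measure1E.
rewrite mu_cylinder size_tuple -natr1 mulrDl mul1r EFinD [leRHS]addeC.
rewrite !probability_setT mule1 mul1e.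
exact: leeD2l.
Qed.

(** The first point agrees with one of the n others on level m with probability
at most n * d ^- m: sum over the d ^ m vertices t the product of the
probabilities d ^- m and n * d ^- m that the first point, respectively one of
the others, passes through t. *)
Lemma power_measure_collision n : (0 < d)%N ->
  (power_measure mu n [set x | ~~ uniq (level_label m x)] <=
     ((n * n)%:R * d%:R ^- m)%:E)%E.
Proof.
move=> d0; elim: n => [|n IHn].
  rewrite mul0r (_ : [set x | _] = set0) ?measure0 //.
  by apply/seteqP; split=> // x; rewrite /= tuple0.
rewrite power_measureS.
set H := [set x : n.-tuple (boundary d) | ~~ uniq (level_label m x)] in IHn *.
pose H' (t : m.-tuple (letter d)) :=
  [set x : n.-tuple (boundary d) | t \in level_label m x].
have mH : measurable H by exact: measurable_dup.
pose C (t : m.-tuple (letter d)) : set (boundary d * n.-tuple (boundary d)) :=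
  cylinder t `*` H' t.
pose D : set (boundary d * n.-tuple (boundary d)) := [set: boundary d] `*` H.
have mC (t : m.-tuple (letter d)) : measurable (C t).
  by apply: measurableX; [exact: measurable_cylinder|exact: measurable_hit].
have mD : measurable D by exact: measurableX.
pose CU := \big[setU/set0]_(t : m.-tuple (letter d)) C t.
have mCU : measurable CU by apply: bigsetU_measurable => t _; exact: mC.
apply: (@le_trans _ _ ((mu \x power_measure mu n)%E (CU `|` D))).
  apply: le_measure; rewrite ?inE.
  - by apply: measurable_consT; exact: measurable_dup.
  - exact: measurableU.
  - move=> [x y] /=; rewrite negb_and negbK => /orP[xy|]; last by right.
    left; rewrite /CU -bigcup_pred; exists (point_prefix m x) => //.
    split=> //=; exact/point_prefix_cylinder.
apply: le_trans (measureU2 _ mCU mD) _.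
rewrite [X in (_ + X)%E](_ : _ = mu setT * power_measure mu n H)%E;
  last exact: product_measure1E.
rewrite probability_setT mul1e.
have -> : ((n.+1 * n.+1)%:R * d%:R ^- m : R) =
    n.+1%:R * d%:R ^- m + n%:R * d%:R ^- m + (n * n)%:R * d%:R ^- m.
  rewrite -!mulrDl -!natrD; congr (_%:R / _); lia.
rewrite [leRHS]EFinD; apply: leeD IHn.
apply: le_trans
  (le_measure_bigsetU (mu \x power_measure mu n)%E mC mCU (@subset_refl _ _)) _.
apply: (@le_trans _ _
  (\sum_(t : m.-tuple (letter d)) (d%:R ^- m * (n%:R * d%:R ^- m))%:E)%E).
  apply: lee_sum => t _.
  rewrite [leLHS](_ : _ = mu (cylinder t) * power_measure mu n (H' t))%E.
    rewrite mu_cylinder size_tuple EFinM.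
    apply: lee_wpmul2l; last exact: power_measure_hit.
    by rewrite lee_fin invr_ge0 exprn_ge0.
  by apply: product_measure1E; [exact: measurable_cylinder|exact: measurable_hit].
rewrite sumEFin lee_fin sumr_const card_tuple card_ord prednK //.
rewrite -[leLHS]mulr_natl natrX mulVKf; last first.
  by rewrite expf_neq0 // pnatr_eq0 -lt0n.
by rewrite lerDr mulr_ge0 ?invr_ge0 ?exprn_ge0.
Qed.

End Collisions.
End BoundaryLevels.

(** * Invariance of the measure on the boundary *)

Section SymmetricPowerFacts.
Context {disp : measure_display} {T : measurableType disp} {n : nat}.

Lemma sym_piP (x y : n.-tuple T) : sym_pi x = sym_pi y <-> perm_eq x y.
Proof.
split=> [/eqmodP/existsP[p /eqP yE]|].
  by rewrite perm_sym; apply/tuple_permP; exists p; rewrite yE.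
rewrite perm_sym => /tuple_permP[p yE]; apply/eqmodP/existsP; exists p.
exact/eqP/val_inj.
Qed.

Lemma measurable_sym (B : set (sym_power T n)) :
  measurable B <-> measurable (sym_pi @^-1` B : set (n.-tuple T)).
Proof.
by rewrite {1}/measurable /= /sym_measurable /image_set_system /= setTI.
Qed.

End SymmetricPowerFacts.

Section BoundaryInvariance.
Context {d : nat} {R : realType}.
Implicit Types g : tree_aut d.

Lemma point_prefix_act m g (x : boundary d) :
  point_prefix m (boundary_act g x) = level_perm m g (point_prefix m x).
Proof. by apply: val_inj; rewrite /= level_permE mkseq_boundary_act. Qed.

Lemma boundary_act_cylinder g (v : vertex d) :
  boundary_act g @^-1` cylinder v = cylinder (g^-1%g v).
Proof.
apply/seteqP; split=> x; rewrite /cylinder /= (size_aut g^-1%g) mkseq_boundary_act.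
  by move=> e; rewrite -[LHS](aut_funK g) e.
by move=> ->; exact: aut_invK.
Qed.

Lemma measurable_boundary_act g :
  measurable_fun setT (boundary_act g : boundary d -> boundary d).
Proof.
have gen : @measurable _ (boundary d) = <<s (range (@cylinder d)) >> by [].
apply: (measurability _ gen) => // _ [_ [v _ <-] <-].
by rewrite setTI boundary_act_cylinder; exact: measurable_cylinder.
Qed.

HB.instance Definition _ g := isMeasurableFun.Build _ _ (boundary d) (boundary d)
  (boundary_act g) (measurable_boundary_act g).

Variable mu : probability (boundary d) R.
Hypothesis mu_cylinder : forall v : vertex d,
  mu (cylinder v) = (d%:R ^- size v)%:E.

(** An automorphism permutes the cylinders of each level, which have the same
measure. The empty set is added to the cylinders to make them stable under
intersection. *)
Lemma boundary_act_invariant g (B : set (boundary d)) : measurable B ->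
  mu (boundary_act g @^-1` B) = mu B.
Proof.
pose C : set (set (boundary d)) := range cylinder `|` [set set0].
have mC : C `<=` measurable.
  by move=> _ [[v _ <-]|->//]; exact: measurable_cylinder.
move=> mB; have sB : <<s C >> B.
  apply: (sub_sigma_algebra2 _ mB); exact: subsetUl.
apply: (@g_sigma_algebra_measure_unique _ R (boundary d) C mC (fun=> cylinder [::]) _ _
  (distribution mu (boundary_act g)) mu _ _ _ _ sB).
- by move=> _; left; exists [::].
- by rewrite bigcup_const //; apply/seteqP; split.
- move=> A B' [[v _ <-]|->]; last by rewrite set0I; right.
  move=> [[w _ <-]|->]; last by rewrite setI0; right.
  wlog vw : v w / (size v <= size w)%N => [H|].
    have [/H //|/ltnW/H] := leqP (size v) (size w).
    by rewrite setIC.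
  have [vpw|vpw] := boolP (prefix v w).
    left; exists w => //; apply/esym/setIidr => x /= wx.
    move: vpw; rewrite prefixE -wx /mkseq -map_take take_iota.
    by rewrite (minn_idPl vw) => /eqP.
  right; apply/seteqP; split=> // x [/= vx wx]; case/negP: vpw.
  by rewrite prefixE -wx /mkseq -map_take take_iota (minn_idPl vw); apply/eqP.
- move=> _ [[v _ <-]|->]; last by rewrite !measure0.
  rewrite [LHS](_ : _ = mu (cylinder (g^-1%g v))); last first.
    by rewrite -boundary_act_cylinder.
  by rewrite mu_cylinder (size_aut g^-1%g); apply/esym/mu_cylinder.
- move=> _; apply: le_lt_trans (probability_le1 _ _) _; last by rewrite ltry.
  exact: measurable_cylinder.
Qed.

End BoundaryInvariance.

(** * Supports of tuples on a level *)

Lemma boundary_ext d (x y : boundary d) :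
  (forall m, point_prefix m x = point_prefix m y) -> x = y.
Proof.
move=> xy; apply/funext => i.
have /(congr1 (fun t => nth ord0 (val t) i)) := xy i.+1.
by rewrite /= !nth_mkseq.
Qed.

Lemma truncation_prefix d k m (x : boundary d) : (k <= m)%N ->
  truncation k (point_prefix m x) = point_prefix k x.
Proof.
move=> km; apply: val_inj; apply: (@eq_from_nth _ ord0); rewrite !size_mkseq //.
by move=> i ik; rewrite !nth_mkseq // (leq_trans ik km).
Qed.

Lemma boundary_act_inj d (g : tree_aut d) : injective (@boundary_act d g).
Proof.
move=> x y xy; apply: boundary_ext => m; apply: (@perm.perm_inj _ (level_perm m g)).
by rewrite -!point_prefix_act xy.
Qed.

Lemma map_uniq_inj (T1 T2 : eqType) (f : T1 -> T2) (s : seq T1) :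
  uniq (map f s) -> {in s &, injective f}.
Proof.
move=> us x y xs ys fxy; apply: (index_inj x xs ys); apply/eqP.
rewrite -(@nth_uniq _ (f x) _ _ _ _ _ us) ?size_map ?index_mem //.
by rewrite !(nth_map x) ?index_mem // !nth_index // fxy.
Qed.

Section Supports.
Context {d n : nat}.
Implicit Types (x : n.-tuple (boundary d)) (g : tree_aut d).

(** Multiplicities can be forgotten because the points of almost every tuple are
pairwise distinct, see [fixes_fixed_set]. *)
Definition support m x : {set m.-tuple (letter d)} := [set t in level_label m x]%SET.

Lemma support_act m g x :
  support m (map_tuple (boundary_act g) x) =
    perm_image (level_perm m g) (support m x).
Proof.
apply/setP => t; rewrite inE; apply/mapP/imsetP.
  move=> [_ /mapP[y yx ->] ->]; exists (point_prefix m y).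
    by rewrite inE map_f.
  by rewrite point_prefix_act.
move=> [s]; rewrite inE => /mapP[y yx ->] ->; exists (boundary_act g y).
  exact: map_f.
by rewrite point_prefix_act.
Qed.

Lemma support_sym m x y : sym_pi x = sym_pi y -> support m x = support m y.
Proof.
move/sym_piP => xy; apply/setP => t; rewrite !inE.
exact/perm_mem/perm_map.
Qed.

Lemma support_truncation k m x : (k <= m)%N ->
  support k x = truncate k (support m x).
Proof.
move=> km; apply/setP => t; rewrite inE; apply/mapP/imsetP.
  move=> [y yx ->]; exists (point_prefix m y); first by rewrite inE map_f.
  by rewrite truncation_prefix.
move=> [s]; rewrite inE => /mapP[y yx ->] ->; exists y => //.
by rewrite truncation_prefix.
Qed.

Lemma card_support m x : (#|support m x| <= n)%N.
Proof.
rewrite cardsE; apply: leq_trans (card_size _) _.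
by rewrite size_map size_tuple.
Qed.

Lemma measurable_support m (p : pred {set m.-tuple (letter d)}) :
  measurable [set x | p (support m x)].
Proof. exact: (measurable_level (fun s : n.-tuple _ => p [set t in s]%SET)). Qed.

Definition fixed_set g : set (n.-tuple (boundary d)) :=
  [set x | perm_eq (map_tuple (boundary_act g) x) x].

Lemma fixed_setE g : sym_pi @^-1` (fixed_points (n := n) g) = fixed_set g.
Proof.
apply/seteqP; split=> x; rewrite /fixed_points /diag /= sym_map_pi.
  by move/sym_piP.
by move=> ?; exact/sym_piP.
Qed.

Lemma fixed_set_fixes m g x : fixed_set g x -> fixes g (support m x).
Proof. by move=> /sym_piP gx; rewrite /fixes -support_act (support_sym _ gx). Qed.

Lemma fixes_support_trunc k m g x : (k <= m)%N ->
  fixes g (support m x) -> fixes g (support k x).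
Proof.
move=> km /eqP gx; rewrite /fixes (support_truncation _ km).
by rewrite -truncate_level_perm // gx.
Qed.

(** If the points already differ on level m, a point of x that agrees with the
image of y under g on level m is unique, so it is the same one that agrees on
every deeper level. *)
Lemma fixes_fixed_set g x m : uniq (level_label m x) ->
  (forall k, fixes g (support k x)) -> fixed_set g x.
Proof.
move=> ux gx.
have sub : {subset map (boundary_act g) x <= x}.
  move=> _ /mapP[y yx ->].
  have pick k : exists2 z, z \in x &
      point_prefix k (boundary_act g y) = point_prefix k z.
    suff : point_prefix k (boundary_act g y) \in support k x.
      by rewrite inE => /mapP.
    rewrite -(eqP (gx k)) point_prefix_act mem_perm_image //.
    by rewrite inE map_f.
  have [z zx zy] := pick m.
  suff -> : boundary_act g y = z by [].
  apply: boundary_ext => k; have [km|/ltnW mk] := leqP k m.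
    by rewrite -!(truncation_prefix _ km) zy.
  have [z' zx' zy'] := pick k.
  suff -> : z = z' by [].
  apply: (map_uniq_inj ux) => //.
  by rewrite -zy -!(truncation_prefix _ mk) zy'.
have uxx : uniq x := map_uniq ux.
have ugx : uniq (map (boundary_act g) x).
  by rewrite map_inj_uniq //; exact: boundary_act_inj.
apply: uniq_perm => //.
by have [] := uniq_min_size ugx sub; rewrite size_map.
Qed.

(** The permutation relating x and its image under g is chosen once for all
levels, which makes the fixed set a finite union of countable intersections. *)
Lemma measurable_fixed_set g : measurable (fixed_set g).
Proof.
rewrite (_ : fixed_set g = \bigcup_(p in [set: 'S_n]) \bigcap_m
  [set x | [forall i,
    level_perm m g (tnth (level_label m x) i) == tnth (level_label m x) (p i)]]).
  apply: fin_bigcup_measurable => [|p _]; first exact: finite_finset.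
  apply: bigcap_measurable => // m _.
  exact: (measurable_level (fun s : n.-tuple _ =>
    [forall i, level_perm m g (tnth s i) == tnth s (p i)])).
apply/seteqP; split=> x.
  move=> /tuple_permP[p px]; exists p => // m _ /=; apply/forallP => i.
  rewrite !tnth_map -point_prefix_act; apply/eqP; congr point_prefix.
  have /(congr1 (fun t => tnth t i)) :
      map_tuple (boundary_act g) x = [tuple tnth x (p i) | i < n].
    exact: val_inj.
  by rewrite tnth_map tnth_mktuple.
move=> [p _ px]; apply/tuple_permP; exists p.
congr val; apply: eq_from_tnth => i; rewrite tnth_map tnth_mktuple.
apply: boundary_ext => m; have /forallP/(_ i)/eqP := px m I.
by rewrite !tnth_map point_prefix_act.
Qed.

End Supports.

(** * The law of the support in an ergodic component *)

Lemma measure_setI_symdiff disp (T : measurableType disp) (R : realType)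
    (mu : {measure set T -> \bar R}) (X Y E : set T) :
    measurable X -> measurable Y -> measurable E ->
  mu (X `+` Y) = 0 -> mu (X `&` E) = mu (Y `&` E).
Proof.
have half (X' Y' : set T) : measurable X' -> measurable Y' -> measurable E ->
    mu (X' `+` Y') = 0 -> (mu (X' `&` E) <= mu (Y' `&` E))%E.
  move=> mX mY mE XY0; have mXY : measurable (X' `+` Y').
    by apply: measurableU; exact: measurableD.
  rewrite -[leRHS]adde0 -XY0.
  apply: le_trans (measureU2 _ _ _) => //; last exact: measurableI.
  apply: le_measure; rewrite ?inE; first exact: measurableI.
    by apply: measurableU; first exact: measurableI.
  move=> x [Xx Ex]; have [Yx|nYx] := pselect (Y' x); first by left.
  by right; left.
move=> mX mY mE XY0; apply/eqP; rewrite eq_le !half //.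
by rewrite [_ `+` _]setUC.
Qed.

Section Component.
Context {d : nat} {R : realType}.
Variables (G : groupClosed (tree_aut d)) (mu : probability (boundary d) R).
Hypothesis d_gt1 : (1 < d)%N.
Hypothesis mu_cylinder : forall v : vertex d,
  mu (cylinder v) = (d%:R ^- size v)%:E.
Variables (n : nat) (A : set (sym_power (boundary d) n)).
Hypothesis hA : ergodic_component G mu A.

Let d_gt0 : (0 < d)%N := ltnW d_gt1.

Let P := power_measure mu n.
Let A' : set (n.-tuple (boundary d)) := sym_pi @^-1` A.

Let mA' : measurable A'.
Proof. by case: hA => /measurable_sym. Qed.

Let PA'_gt0 : (0 < P A')%E. Proof. by case: hA. Qed.

Let P_fin (B : set (n.-tuple (boundary d))) : measurable B -> P B \is a fin_num.
Proof. by move=> mB; exact: fin_num_measure. Qed.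

Let PA'_real : 0 < fine (P A').
Proof. by rewrite -lte_fin fineK // P_fin. Qed.

Let act g : n.-tuple (boundary d) -> n.-tuple (boundary d) :=
  map_tuple (boundary_act g).

Let mact g B : measurable B -> measurable (act g @^-1` B).
Proof.
move=> mB; rewrite -[X in measurable X]setTI.
exact: (measurable_map_tuple (measurable_boundary_act g)).
Qed.

Let P_act g B : measurable B -> P (act g @^-1` B) = P B.
Proof.
apply: power_measure_invariant; first exact: measurable_boundary_act.
by move=> C; exact: boundary_act_invariant.
Qed.

Let sym_act g (B : set (sym_power (boundary d) n)) :
  sym_pi @^-1` (diag g @^-1` B) = act g @^-1` (sym_pi @^-1` B).
Proof. by apply/seteqP; split=> x; rewrite /= /diag sym_map_pi. Qed.

Let A'_invariant g : g \in G -> P ((act g @^-1` A') `+` A') = 0%E.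
Proof.
move=> gG; case: hA => _ _ /(_ g gG) + _.
by rewrite /sym_measure /= /distribution /pushforward -sym_act.
Qed.

Definition level_prob m (p : pred {set m.-tuple (letter d)}) : R :=
  fine (P (A' `&` [set x | p (support m x)])) / fine (P A').

Let msupport := @measurable_support d n.

Let weight m S := P (A' `&` [set x | support m x = S]).

Let measurable_fiber m (S : {set m.-tuple (letter d)}) :
  measurable [set x : n.-tuple (boundary d) | support m x = S].
Proof.
rewrite (_ : [set x | _] = [set x | pred1 S (support m x)]); first exact: msupport.
by apply/seteqP; split=> x /= /eqP.
Qed.

Let mweight m S : measurable (A' `&` [set x | @support d n m x = S]).
Proof. exact: measurableI. Qed.

Let weight_act m g (S : {set m.-tuple (letter d)}) : g \in G ->
  weight (perm_image (level_perm m g) S) = weight S.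
Proof.
move=> gG; rewrite /weight -(P_act g) //.
rewrite (_ : _ @^-1` _ = (act g @^-1` A') `&` [set x | support m x = S]).
  apply: measure_setI_symdiff => //; [exact: mact|exact: A'_invariant].
apply/seteqP; split=> x [? /=]; rewrite support_act.
  by move/(can_inj (perm_imageK _)).
by move=> ->.
Qed.

Let prob_sum m (p : pred {set m.-tuple (letter d)}) :
  P (A' `&` [set x | p (support m x)]) = (\sum_(S | p S) weight S)%E.
Proof. exact: (measure_label_sum (@measurable_fiber m) P p mA'). Qed.

(** The points of A whose support lies in one orbit of G on the sets of vertices
of level m form an invariant subset. Ergodicity gives it full measure in A as
soon as its measure is positive. *)
Let weight_ergodic m : exists2 S0 : {set m.-tuple (letter d)}, (#|S0| <= n)%N &
  forall S : {set m.-tuple (letter d)},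
    S \notin [set perm_image q S0 | q in level_group G m]%SET -> weight S = 0%E.
Proof.
have [S0 w0] : exists S0 : {set m.-tuple (letter d)}, (0 < weight S0)%E.
  apply: contrapT => noS; have := PA'_gt0.
  rewrite -[A']setIT (_ : setT = [set x | predT (support m x)]);
    last by apply/seteqP; split.
  rewrite prob_sum big1 ?ltxx // => S _; apply/eqP.
  by rewrite eq_le measure_ge0 andbT leNgt; apply/negP => wS; apply: noS; exists S.
exists S0.
  have [x [_ /= <-]] : A' `&` [set x | support m x = S0] !=set0.
    apply/set0P/eqP => e0; move: w0; by rewrite /weight e0 measure0 ltxx.
  exact: card_support.
set O := [set perm_image q S0 | q in level_group G m]%SET.
pose B := A `&` [set y | support m (repr y) \in O].
have BE : sym_pi @^-1` B = A' `&` [set x | support m x \in O].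
  apply/seteqP; split=> x [Ax /=].
    by rewrite (@support_sym _ _ m _ x) //; exact: reprK.
  by move=> xO; split=> //=; rewrite (@support_sym _ _ m _ x) //; exact: reprK.
have mB' : measurable (A' `&` [set x | support m x \in O]).
  by apply: measurableI => //; exact: (msupport (fun S => S \in O)).
have mB : measurable B by apply/measurable_sym; rewrite BE.
have actO g (S : {set m.-tuple (letter d)}) :
    g \in G -> (perm_image (level_perm m g) S \in O) = (S \in O).
  move=> gG; have gQ : level_perm m g \in level_group G m.
    by apply/level_imageP; exists g.
  apply/imsetP/imsetP => -[q qQ SE]; last first.
    by exists (q * level_perm m g)%g; rewrite ?groupM // perm_imageM SE.
  exists (q * (level_perm m g)^-1)%g; first by rewrite groupM ?groupV.
  by rewrite perm_imageM -SE perm_imageK.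
have B_inv : null_invariant G mu B.
  move=> g gG; apply/eqP; rewrite eq_le measure_ge0 andbT.
  rewrite -[leRHS](A'_invariant gG).
  rewrite [leLHS](_ : _ =
    P ((act g @^-1` (sym_pi @^-1` B)) `+` (sym_pi @^-1` B))); last first.
    by rewrite -sym_act.
  rewrite BE; apply: le_measure; rewrite ?inE.
  - by apply: measurableU; apply: measurableD => //; exact: mact.
  - by apply: measurableU; apply: measurableD => //; exact: mact.
  - move=> x [] [] /=; rewrite support_act actO // => -[Ax Ox] nAx.
      by left; split => // ?; apply: nAx.
    by right; split => // ?; apply: nAx.
case: hA => _ _ _ /(_ B mB (@subIsetl _ _ _) B_inv).
rewrite /sym_measure /= /distribution /pushforward BE => -[B0|AB0].
  suff : (weight S0 <= 0)%E by rewrite leNgt w0.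
  rewrite -B0; apply: le_measure; rewrite ?inE //.
  move=> x [Ax /= ->]; split=> //; rewrite /= -[S0]perm_image1.
  exact/imset_f/group1.
move=> S SO; apply/eqP; rewrite eq_le measure_ge0 andbT -[leRHS]AB0.
have ABE : sym_pi @^-1` (A `\` B) = A' `\` (A' `&` [set x | support m x \in O]).
  by rewrite -BE.
rewrite ABE; apply: le_measure; rewrite ?inE //; first exact: measurableD.
by move=> x [Ax /= xS]; split=> // -[_ /=]; rewrite xS (negPf SO).
Qed.

(** The law of the support on level m is invariant under G and, by ergodicity,
carried by one orbit. It is the law of the image of S0 under a uniformly chosen
element of the finite group induced by G. *)
Lemma level_prob_orbit m : exists2 S0 : {set m.-tuple (letter d)}, (#|S0| <= n)%N &
  forall p, level_prob p * #|level_group G m|%:R =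
    #|[set q in level_group G m | p (perm_image q S0)]%SET|%:R.
Proof.
have [S0 cS0 w0] := weight_ergodic m; exists S0 => // p.
pose w (S : {set m.-tuple (letter d)}) := fine (weight S).
have fsum (r : pred {set m.-tuple (letter d)}) :
    fine (P (A' `&` [set x | r (support m x)])) = \sum_S w S * (r S)%:R.
  rewrite prob_sum -sum_fine => [|S _]; last by apply: P_fin; exact: mweight.
  by rewrite big_mkcond; apply: eq_bigr => S _; case: (r S); rewrite (mulr1, mulr0).
have cardE (S : {set m.-tuple (letter d)}) :
    #|[set q in level_group G m | p (perm_image q S)]%SET|%:R =
    \sum_(q in level_group G m) (p (perm_image q S))%:R :> R.
  rewrite -sum1_card natr_sum big_mkcond [RHS]big_mkcond; apply: eq_bigr => q _.
  by rewrite inE; case: (q \in _); case: (p _).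
set K := (X in _ = X).
have orbK S : w S * (\sum_(q in level_group G m) (p (perm_image q S))%:R) = w S * K.
  have [/imsetP[s sQ ->]|/w0 S0'] :=
    boolP (S \in [set perm_image q S0 | q in level_group G m]%SET);
    last by rewrite /w S0' !mul0r.
  congr (_ * _); rewrite /K cardE [RHS](reindex_inj (mulgI s)) /=.
  apply: eq_big => q; first exact/esym/(groupMl q sQ).
  by rewrite perm_imageM.
rewrite /level_prob mulrAC; apply: (canLR (mulfK (lt0r_neq0 PA'_real))).
have -> : fine (P A') = \sum_S w S.
  transitivity (fine (P (A' `&` [set x | predT (support m x)]))).
    by congr (fine (P _)); apply/seteqP; split=> [x ?|x []].
  by rewrite fsum; apply: eq_bigr => S _; rewrite mulr1.
rewrite fsum [RHS]mulr_sumr; under [RHS]eq_bigr => S _ do rewrite mulrC -orbK mulr_sumr.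
rewrite exchange_big /= mulr_natr -sumr_const; apply: eq_bigr => q qQ.
rewrite [LHS](reindex_inj (can_inj (perm_imageK q))) /=; apply: eq_bigr => S _.
by have /level_imageP[g gG <-] := qQ; rewrite /w weight_act.
Qed.

(** The character as a real function on the whole automorphism group. *)
Definition fixed_prob (g : tree_aut d) : R :=
  component_measure mu A (fixed_points g `&` A).

Lemma fixed_probE g : fixed_prob g = fine (P (A' `&` fixed_set g)) / fine (P A').
Proof.
rewrite /fixed_prob /component_measure -(fixed_setE g) -setIA setIid setIC.
by [].
Qed.

Let mfixes m g : measurable (A' `&` [set x | fixes g (@support d n m x)]).
Proof. by apply: measurableI => //; exact: (msupport (fixes g)). Qed.

Let mfixed g : measurable (A' `&` fixed_set g).
Proof. by apply: measurableI => //; exact: measurable_fixed_set. Qed.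

Lemma fixed_prob_le m g : fixed_prob g <= level_prob (@fixes d m g).
Proof.
rewrite fixed_probE; apply: ler_wpM2r; first by rewrite invr_ge0 ltW.
apply: fine_le; rewrite ?P_fin //.
apply: le_measure; rewrite ?inE // => x [Ax gx]; split=> //.
exact: fixed_set_fixes.
Qed.

Let collision_null :
  P (\bigcap_m [set x : n.-tuple (boundary d) | ~~ uniq (level_label m x)]) = 0%E.
Proof.
set N := \bigcap_m _.
have mD m : measurable [set x : n.-tuple (boundary d) | ~~ uniq (level_label m x)].
  exact: (measurable_level (fun s : n.-tuple _ => ~~ uniq s)).
have mN : measurable N by apply: bigcap_measurable.
apply/eqP; rewrite eq_le measure_ge0 andbT -(fineK (P_fin mN)) lee_fin leNgt.
apply/negP => r_gt0; set r := fine _ in r_gt0.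
(* The bound n ^ 2 * d ^- m is below r for this m, because m < d ^ m. *)
pose m := Num.bound ((n * n)%:R / r).
have : (n * n)%:R / r < m%:R by apply: archi_boundP; rewrite divr_ge0 // ltW.
rewrite ltr_pdivrMr // ltNge => /negP; apply.
have rm : r <= (n * n)%:R * d%:R ^- m.
  rewrite -lee_fin /r fineK ?P_fin //.
  apply: le_trans (power_measure_collision mu_cylinder m n d_gt0).
  by apply: le_measure; rewrite ?inE // => x /(_ m I).
apply: (@le_trans _ _ (d%:R ^+ m * r)).
  apply: ler_wpM2r; first exact: ltW.
  by rewrite -natrX ler_nat ltnW // ltn_expl.
rewrite mulrC -ler_pdivlMr // exprn_gt0 // ltr0n //.
Qed.

(** The events that g fixes the support on level m decrease with m. A tuple in all
of them is fixed by g in the symmetric power, unless two of its points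
coincide, and this has probability zero. *)
Lemma level_prob_cvg g : (fun m => level_prob (@fixes d m g)) @ \oo --> fixed_prob g.
Proof.
rewrite fixed_probE; apply: cvgM; last exact: cvg_cst.
pose F m := A' `&` [set x | fixes g (@support d n m x)].
have mcapF : measurable (\bigcap_m F m).
  by apply: bigcap_measurable => // m _; exact: mfixes.
have cvgF : P (F m) @[m --> \oo] --> P (\bigcap_m F m).
  apply: nonincreasing_cvg_mu => //.
  - rewrite -ge0_fin_numE ?measure_ge0 //; apply: P_fin; exact: mfixes.
  - by move=> m; exact: mfixes.
  - move=> k m km; rewrite subsetEset => x [Ax gx]; split=> //.
    exact: fixes_support_trunc km gx.
have <- : P (\bigcap_m F m) = P (A' `&` fixed_set g).
  apply/eqP; rewrite eq_le; apply/andP; split; last first.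
    apply: le_measure; rewrite ?inE // => x [Ax gx] m _; split=> //.
    exact: fixed_set_fixes.
  rewrite -[leRHS]adde0 -collision_null.
  set N := (X in (_ + P X)%E).
  have mN : measurable N.
    apply: bigcap_measurable => // m _.
    exact: (measurable_level (fun s : n.-tuple _ => ~~ uniq s)).
  apply: le_trans (measureU2 _ (mfixed g) mN).
  apply: le_measure; rewrite ?inE //; first exact: measurableU.
  move=> x gx; have [Nx|] := pselect (N x); first by right.
  move=> /existsNP[m /not_implyP[_ /negP]]; rewrite negbK => ux; left; split.
    by have [] := gx 0%N I.
  by apply: (fixes_fixed_set ux) => k; have [] := gx k I.
apply: fine_cvg; rewrite fineK ?P_fin //.
Qed.

End Component.

(** * The character as a limit of permutation characters *)

(** The coefficient of each value t of T contributes the squared modulus of the sum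
of the u i with T i = t. *)
Lemma psd_indicator (R : realType) (I J : finType) (u : I -> R[i]) (T : I -> J) :
  0 <= \sum_i \sum_j u i * (T i == T j)%:R * (u j)^*.
Proof.
have -> : \sum_i \sum_j u i * (T i == T j)%:R * (u j)^* =
    \sum_t (\sum_(i | T i == t) u i) * (\sum_(i | T i == t) u i)^*.
  transitivity (\sum_i u i * (\sum_(j | T j == T i) u j)^*).
    apply: eq_bigr => i _; rewrite rmorph_sum mulr_sumr [RHS]big_mkcond.
    apply: eq_bigr => j _; rewrite eq_sym.
    by case: eqP; rewrite ?mulr1 ?mulr0 ?mul0r.
  rewrite (partition_big T predT) //=; apply: eq_bigr => t _.
  by rewrite mulr_suml; apply: eq_bigr => i /eqP ->.
by apply: sumr_ge0 => t _; exact: mul_conjC_ge0.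
Qed.

Lemma cvg_sumr (R : realType) (I : Type) (s : seq I) (F : I -> nat -> R) (l : I -> R) :
    (forall i, F i @ \oo --> l i) ->
  (fun m => \sum_(i <- s) F i m) @ \oo --> \sum_(i <- s) l i.
Proof.
move=> Fl; elim: s => [|i s IHs].
  rewrite big_nil; under eq_fun do rewrite big_nil; exact: cvg_cst.
rewrite big_cons; under eq_fun do rewrite big_cons; exact: cvgD.
Qed.

(** The order of the complex numbers compares real parts and requires equal
imaginary parts, so the limit is taken separately in each. *)
Lemma psd_limit (R : realType) (k : nat) (u : 'I_k -> R[i])
    (p : nat -> 'I_k -> 'I_k -> R) (l : 'I_k -> 'I_k -> R) :
    (forall i j, (fun m => p m i j) @ \oo --> l i j) ->
    (forall m, 0 <= \sum_i \sum_j u i * (p m i j)%:C%C * (u j)^*) ->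
  0 <= \sum_i \sum_j u i * (l i j)%:C%C * (u j)^*.
Proof.
move=> pl psd.
have ReE (c : 'I_k -> 'I_k -> R) :
    complex.Re (\sum_i \sum_j u i * (c i j)%:C%C * (u j)^*) =
    \sum_i \sum_j complex.Re (u i * (u j)^*) * c i j.
  rewrite raddf_sum; apply: eq_bigr => i _; rewrite raddf_sum; apply: eq_bigr => j _ /=.
  by rewrite mulrAC; case: (u i * _) => a b /=; rewrite mulr0 subr0.
have ImE (c : 'I_k -> 'I_k -> R) :
    complex.Im (\sum_i \sum_j u i * (c i j)%:C%C * (u j)^*) =
    \sum_i \sum_j complex.Im (u i * (u j)^*) * c i j.
  rewrite raddf_sum; apply: eq_bigr => i _; rewrite raddf_sum; apply: eq_bigr => j _ /=.
  by rewrite mulrAC; case: (u i * _) => a b /=; rewrite mulr0 add0r.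
have lim (c : 'I_k -> 'I_k -> R) : (fun m => \sum_i \sum_j c i j * p m i j) @ \oo -->
    \sum_i \sum_j c i j * l i j.
  apply: cvg_sumr => i; apply: cvg_sumr => j.
  by apply: cvgM => //; exact: cvg_cst.
rewrite lecE ReE ImE /=; apply/andP; split.
  apply/eqP; apply: (cvg_unique _ (lim _)) => //.
  rewrite [X in X @ _](_ : _ = cst 0); first exact: cvg_cst.
  apply/funext => m; rewrite -ImE.
  by have := psd m; rewrite lecE => /andP[/eqP].
have <- := cvg_lim _ (lim (fun i j => complex.Re (u i * (u j)^*))) => //.
apply: limr_ge; first by apply/cvg_ex; eexists; exact: lim.
by apply: nearW => m; rewrite -ReE; have := psd m; rewrite lecE => /andP[].
Qed.

(** The arithmetic of [conjugate_spread]: K is the order of the finite group, T the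
number of collisions, al and ga the probabilities that g fixes the support on
the levels m and k, and p their limit. *)
Lemma spread_bound (R : realFieldType) (L T K N s p e al ga : R) :
    0 < L -> 0 < K -> s <= N -> N <= e * L -> 0 < e ->
    0 <= p -> p <= al -> al <= 1 -> ga <= p + e -> al <= ga ->
    L * T <= L * (al * K * (al * K) + (ga * K - al * K) * K) + s * K * K ->
  T <= (p ^+ 2 + e * 4%:R) * K ^+ 2.
Proof.
move=> L0 K0 sN Ne e0 p0 pal al1 gap alga LT.
have sq : al * al <= p ^+ 2 + e * 2%:R.
  have : al * al <= al * (p + e) by apply: ler_wpM2l; lra.
  have : p * al <= p * (p + e) by apply: ler_wpM2l; lra.
  have : e * al <= e * 1 by apply: ler_wpM2l; lra.
  have : e * p <= e * 1 by apply: ler_wpM2l; lra.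
  rewrite expr2; lra.
have K20 : 0 <= K ^+ 2 by rewrite exprn_ge0 // ltW.
rewrite -(ler_pM2l L0); apply: le_trans LT _.
have -> : L * (al * K * (al * K) + (ga * K - al * K) * K) + s * K * K =
    (L * (al * al + (ga - al)) + s) * K ^+ 2 by ring.
rewrite [leRHS]mulrA; apply: ler_wpM2r => //.
have : L * (al * al + (ga - al)) <= L * (p ^+ 2 + e * 3%:R).
  by apply: ler_wpM2l; lra.
lra.
Qed.

Section MainProof.
Context {d : nat} {R : realType}.
Variables (G : groupClosed (tree_aut d)) (mu : probability (boundary d) R).
Hypothesis d_gt1 : (1 < d)%N.
Hypothesis mu_cylinder : forall v : vertex d,
  mu (cylinder v) = (d%:R ^- size v)%:E.
Variables (n : nat) (A : set (sym_power (boundary d) n)).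
Hypothesis hA : ergodic_component G mu A.

Let orbit m := level_prob_orbit mu_cylinder hA m.

Let fix_cvg g :
  (fun m => level_prob mu A (@fixes d m g)) @ \oo --> fixed_prob mu A g.
Proof. exact: (level_prob_cvg d_gt1 mu_cylinder hA (g := g)). Qed.
Arguments fix_cvg : clear implicits.

Let Q m := level_group G m.

Let Q_gt0 m : 0 < #|Q m|%:R :> R.
Proof. by rewrite ltr0n cardG_gt0. Qed.

Lemma fixed_prob1 : fixed_prob mu A 1%g = 1.
Proof.
have := fix_cvg 1%g; rewrite [X in X @ _](_ : _ = cst 1).
  by move=> /(cvg_unique _ (cvg_cst _)) <-.
apply/funext => m; have [S0 _ count] := orbit m.
apply: (mulIf (lt0r_neq0 (Q_gt0 m))); rewrite count mul1r.
congr _%:R; apply: eq_card => q; rewrite finset.in_set /fixes.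
by rewrite level_perm1 perm_image1 eqxx andbT.
Qed.

(** On each level this is the invariance of the law of the support under h. *)
Lemma fixed_probC g h : h \in G ->
  fixed_prob mu A (g * h)%g = fixed_prob mu A (h * g)%g.
Proof.
move=> hG; apply: (cvg_unique _ (fix_cvg _)) => //.
rewrite [X in X @ _](_ : _ = fun m => level_prob mu A (@fixes d m (h * g)%g)).
  exact: fix_cvg.
apply/funext => m; have [S0 _ count] := orbit m.
apply: (mulIf (lt0r_neq0 (Q_gt0 m))); rewrite !count.
congr _%:R.
pose f q := fixes (h * g)%g (perm_image q S0).
rewrite -(@card_reindex _ (Q m) f (fun q => (q * level_perm m h)%g)).
- apply: eq_card => q; rewrite !finset.in_set /f perm_imageM.
  by rewrite -{2}[g](mulgK h) [(h * _)%g]mulgA conj_fixes perm_imageK.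
- exact: mulIg.
- move=> q; apply: groupMr; apply/level_imageP; by exists h.
Qed.

(** At level m, x i * (x j)^-1 fixes a set exactly when (x i)^-1 and (x j)^-1 have
the same image on it, so [psd_indicator] applies to each set of the orbit. *)
Lemma fixed_prob_psd (k : nat) (x : 'I_k -> tree_aut d) (u : 'I_k -> R[i]) :
  0 <= \sum_i \sum_j u i * (fixed_prob mu A (x i * (x j)^-1)%g)%:C%C * (u j)^*.
Proof.
apply: (psd_limit (fun i j => fix_cvg (x i * (x j)^-1)%g)) => m.
have [S0 _ count] := orbit m.
have QC0 : 0 < (#|Q m|%:R : R)%:C%C by rewrite ltcR.
rewrite -(pmulr_rge0 _ QC0) mulr_sumr.
pose T q i := perm_image (level_perm m (x i)^-1%g) (perm_image q S0).
have fixesE q i j : fixes (x i * (x j)^-1)%g (perm_image q S0) = (T q i == T q j).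
  rewrite /fixes level_permM perm_imageM -/(T q j).
  rewrite -(inj_eq (@perm_image_inj _ (level_perm m (x i)^-1%g))).
  rewrite [X in X == _](_ : _ = T q j) 1?eq_sym //.
  by rewrite level_permV perm_imageK.
rewrite (_ : \sum_i _ = \sum_(q in Q m) \sum_i \sum_j
    u i * (T q i == T q j)%:R * (u j)^*).
  by apply: sumr_ge0 => q _; exact: psd_indicator.
rewrite exchange_big /=; apply: eq_bigr => i _.
rewrite exchange_big mulr_sumr; apply: eq_bigr => j _ /=.
rewrite -mulr_suml -mulr_sumr mulrA; congr (_ * _).
rewrite mulrCA; congr (_ * _); rewrite -rmorphM mulrC count rmorph_nat.
rewrite -sum1_card natr_sum big_mkcond [RHS]big_mkcond; apply: eq_bigr => q _.
rewrite finset.in_set fixesE; case: (q \in _) => //=.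
by case: (_ == _).
Qed.

Lemma component_character_is_character :
  is_character (component_character (G := G) mu A).
Proof.
split=> [g h|k g|].
- by congr (_%:C%C); apply: fixed_probC; exact: valP.
- apply/psdmxE => u; have := fixed_prob_psd (fun i => val (g i)) u.
  congr (is_true (0 <= _)); apply: eq_bigr => i _; apply: eq_bigr => j _.
  by rewrite mxE.
- by congr (_%:C%C); exact: fixed_prob1.
Qed.

(** * Averages over the conjugates of an element *)

Lemma fixed_prob_ge0 g : 0 <= fixed_prob mu A g.
Proof. by rewrite divr_ge0 // fine_ge0. Qed.

Lemma level_prob_le1 m (p : pred {set m.-tuple (letter d)}) : level_prob mu A p <= 1.
Proof.
have [S0 _ count] := orbit m.
rewrite -(ler_pM2r (Q_gt0 m)) count mul1r ler_nat.
by apply: subset_leq_card; apply/fintype.subsetP => q; rewrite finset.in_set => /andP[].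
Qed.

Lemma level_prob_truncate k m (p : pred {set k.-tuple (letter d)}) : (k <= m)%N ->
  level_prob mu A (fun S : {set m.-tuple (letter d)} => p (truncate k S)) =
    level_prob mu A p.
Proof.
move=> km; rewrite /level_prob; congr (fine (power_measure mu n (_ `&` _)) / _).
by apply/seteqP; split=> x /=; rewrite -support_truncation.
Qed.

(** First k is chosen so that g fixes the support on level k with probability close
to the limit, then m so that the orbits of [rist_orbit_large] are long. The
value of the character at a product of conjugates is at most the probability
that the two conjugates have the same image on the support on level m, which
turns the sum into the count of [conjugate_collisions], for each set of the
orbit. *)
Lemma conjugate_spread (G_branch : is_branch G) (g : tree_aut d) (e : R) :
    g \in G -> 0 < e ->
  exists m (lift : {perm m.-tuple (letter d)} -> tree_aut d),
    (forall q, q \in Q m -> lift q \in G) /\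
    \sum_(q in Q m) \sum_(q' in Q m)
      fixed_prob mu A
        ((lift q * g * (lift q)^-1)^-1 * (lift q' * g * (lift q')^-1))%g
      <= (fixed_prob mu A g ^+ 2 + e) * #|Q m|%:R ^+ 2.
Proof.
move=> gG e0; set p := fixed_prob mu A g.
(* Of the four parts, two come from al ^+ 2 against p ^+ 2, one from ga - al and
   one from n / L, see [spread_bound]. *)
pose e' := e / 4%:R; have e'0 : 0 < e' by rewrite divr_gt0.
have [k pk] : exists k, level_prob mu A (@fixes d k g) <= p + e'.
  have : \forall m \near \oo, level_prob mu A (@fixes d m g) <= p + e'.
    by apply: (cvgr_le _ (fix_cvg g)); rewrite ltrDl.
  by case=> k _ /(_ k) /(_ (leqnn k)); exists k.
pose L := (Num.bound (n%:R / e')).+1.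
have Le : n%:R <= e' * L%:R.
  rewrite mulrC -ler_pdivrMr //; apply: ltW; apply: lt_le_trans (_ : _ <= _).
    by apply: archi_boundP; rewrite divr_ge0 // ltW.
  by rewrite ler_nat.
have [m km orb] := rist_orbit_large k L d_gt1 G_branch.
have [S0 S0n count] := orbit m.
have /choice[lift liftP] : forall q : {perm m.-tuple (letter d)}, exists h,
    q \in Q m -> h \in G /\ level_perm m h = q.
  move=> q; have [/level_imageP[h hG hq]|] := boolP (q \in Q m).
    by exists h.
  by exists 1%g.
exists m, lift; split=> [q /liftP[]//|].
set K := #|Q m|%:R; have K0 : 0 < K := Q_gt0 m.
pose F S q := perm_image (level_perm m g ^ q)%g S.
pose T s := (\sum_(q in Q m) \sum_(q' in Q m)
  (F (perm_image s S0) q' == F (perm_image s S0) q))%N.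
have le_T : (\sum_(q in Q m) \sum_(q' in Q m)
      fixed_prob mu A
        ((lift q * g * (lift q)^-1)^-1 * (lift q' * g * (lift q')^-1))%g) * K
    <= \sum_(s in Q m) (T s)%:R.
  have fixesE q q' S : q \in Q m -> q' \in Q m ->
      fixes ((lift q * g * (lift q)^-1)^-1 * (lift q' * g * (lift q')^-1))%g S
        = (F S q' == F S q).
    move=> /liftP[_ hq] /liftP[_ hq'].
    rewrite /fixes level_permM perm_imageM level_permV !level_perm_conj hq hq'.
    rewrite -/(F S q') -(inj_eq (@perm_image_inj _ (level_perm m g ^ q)%g)).
    by rewrite perm_imageVK.
  under [leRHS]eq_bigr => s _.
    rewrite /T natr_sum; under eq_bigr => q _ do rewrite natr_sum.
    over.
  rewrite mulr_suml exchange_big; apply: ler_sum => q qQ /=.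
  rewrite mulr_suml exchange_big; apply: ler_sum => q' q'Q /=.
  apply: le_trans (ler_wpM2r (ltW K0) (fixed_prob_le hA m _)) _.
  rewrite count -sum1_card natr_sum big_mkcond [leRHS]big_mkcond.
  apply: ler_sum => s _; rewrite finset.in_set fixesE //.
  by case: (s \in Q m); case: (_ == _).
have T_le s : s \in Q m -> (T s)%:R <= (p ^+ 2 + e) * K ^+ 2.
  move=> sQ; set S := perm_image s S0.
  have countS (f : pred {set m.-tuple (letter d)}) :
      #|[set q in Q m | f (perm_image q^-1%g S)]%SET|%:R = level_prob mu A f * K.
    rewrite count; congr _%:R.
    rewrite -(@card_reindex _ (Q m) (fun q => f (perm_image q S0))
      (fun q => (s * q^-1)%g)).
    - by apply: eq_card => q; rewrite !finset.in_set perm_imageM.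
    - by move=> q q' /mulgI/invg_inj.
    - by move=> q; rewrite (groupMl _ sQ) groupV.
  have := conjugate_collisions gG km orb (S := S) erefl erefl.
  set a := #|[set q in _ | fixes g _]%SET|.
  set c := #|[set q in _ | _]%SET|.
  rewrite -(ler_nat R) -/(T s) => le_LT.
  have aE : a%:R = level_prob mu A (@fixes d m g) * K by exact: countS.
  have cE : c%:R = level_prob mu A (@fixes d k g) * K.
    by rewrite -(level_prob_truncate _ km); exact: countS.
  have ac : (a <= c)%N.
    apply: subset_leq_card; apply/fintype.subsetP => q.
    rewrite !finset.in_set => /andP[-> /eqP Sq] /=.
    by rewrite /fixes -truncate_level_perm // Sq.
  have Sn : #|S|%:R <= n%:R :> R by rewrite ler_nat card_perm_image.
  move: le_LT; rewrite !(natrM, natrD) natrB // aE cE -/K -/(T s).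
  set al := level_prob _ _ _; set ga := level_prob _ _ _.
  have palE := fixed_prob_le hA m g; have al1 := level_prob_le1 (@fixes d m g).
  have alga : al <= ga by rewrite -(ler_pM2r K0) -aE -cE ler_nat.
  have L0 : 0 < L%:R :> R by rewrite ltr0n.
  have -> : e = e' * 4%:R by rewrite /e' divfK // pnatr_eq0.
  exact: (spread_bound L0 K0 Sn Le e'0 (fixed_prob_ge0 g)).
rewrite -(ler_pM2r K0); apply: le_trans le_T _.
apply: le_trans (ler_sum _ T_le) _.
by rewrite sumr_const -mulr_natr.
Qed.

Lemma component_character_indecomposable : is_branch G ->
  indecomposable (component_character (G := G) mu A).
Proof.
move=> G_branch; apply: indecomposable_spread => g e e0.
have [m [lift [liftG spread]]] := conjugate_spread G_branch (valP g) e0.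
pose q (i : 'I_#|Q m|) := enum_val i.
pose h (i : 'I_#|Q m|) : subgroup_type G := Sub (lift (q i)) (liftG _ (enum_valP i)).
exists #|Q m|, (fun i => h i * g * (h i)^-1)%g; split; first exact: cardG_gt0.
split=> [i|]; first by exists (h i).
have -> : `|component_character (G := G) mu A g| ^+ 2 =
    (fixed_prob mu A (val g) ^+ 2)%:C%C.
  by rewrite rmorphXn /= ger0_norm // lecR fixed_prob_ge0.
have -> : #|Q m|%:R ^+ 2 = (#|Q m|%:R ^+ 2)%:C%C :> R[i] by rewrite rmorphXn rmorph_nat.
rewrite -rmorphD -rmorphM.
rewrite [leLHS](_ : _ = (\sum_(q in Q m) \sum_(q' in Q m)
    fixed_prob mu A ((lift q * val g * (lift q)^-1)^-1 *
      (lift q' * val g * (lift q')^-1))%g)%:C%C).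
  by rewrite lecR.
rewrite rmorph_sum [RHS]big_enum_val; apply: eq_bigr => i _ /=.
by rewrite rmorph_sum [RHS]big_enum_val; apply: eq_bigr => j _.
Qed.

End MainProof.

Theorem corollary17 (R : realType) (d : nat) (hd : (2 <= d)%N)
  (G : groupClosed (tree_aut d)) (G_countable : countable [set` G])
  (G_branch : is_branch G)
  (mu : probability (boundary d) R)
  (mu_cylinder : forall v : vertex d,
     mu (cylinder v) = (d%:R ^- size v)%:E)
  (n : nat) (A : set (sym_power (boundary d) n))
  (hA : ergodic_component G mu A) :
  is_character (component_character (G := G) mu A) /\
  indecomposable (component_character (G := G) mu A).
Proof.
split; first exact: (component_character_is_character hd mu_cylinder hA).
exact: (component_character_indecomposable hd mu_cylinder hA G_branch).
Qed.
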